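(* In the model with endogenous complexity described in the context, the optimal team size (chosen jointly with the process $Q$) is (weakly) decreasing in the cost parameter $\eta$, and converges to the zero-attention-capacity solution as $\eta\to0$.
   Context: Baseline process: $P$ is the law of a mean-zero Gaussian process on $[0,1]$ with symmetric, continuous, positive definite covariance kernel with finite integrated variance and eigenvalues $\lambda_1\ge\lambda_2\ge\dots>0$ (infinitely many strictly positive). The function $f:[1,\infty)\to\mathbb R$ is strictly increasing and differentiable, $f(1)=1$, $\lim_{k\to\infty}f(k)=\infty$. Attention capacity $\rho>0$ is fixed. The organization chooses a team size $k\in[1,\infty)$ and a feasible $Q$, i.e. the law of a mean-zero Gaussian process on $[0,1]$ whose covariance kernel is continuous and positive definite with finite integrated variance, at cost $\eta D(Q\|P)$, where $\eta>0$ and $D$ is Kullback–Leibler divergence. If $Q$ has covariance eigenvalues $\tilde\lambda_1\ge\tilde\lambda_2\ge\cdots$, let $\tilde\mu>0$ solve $\frac12\sum_i\max\{0,\log(\tilde\lambda_i/\tilde\mu)\}=\rho$ and $n=\#\{i:\tilde\lambda_i>\tilde\mu\}$ (water-filling solution of headquarters' attention problem for the process $Q$). The organization minimizes over $(k,Q)$ the total loss $$\frac1{4k}\Big(n\tilde\mu+\sum_{i>n}\tilde\lambda_i\Big)+\frac{f(k)}2\sum_{i\ge1}\tilde\lambda_i+\eta D(Q\|P).$$ Without loss $Q$ has the same Karhunen–Loève eigenfunctions as $P$, in which case $D(Q\|P)=\frac12\sum_j\big(\tilde\lambda_j/\lambda_j-1-\log(\tilde\lambda_j/\lambda_j)\big)$.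 The optimal team size is the optimal $k$. The zero-attention-capacity solution is the team size that is optimal when $\rho=0$, i.e. the minimizer of $\frac1{4k}+\frac{f(k)}2$ over $k\in[1,\infty)$. *)

(* Defs.v *)
From HB Require Import structures.
From mathcomp Require Import all_boot all_order all_algebra finmap.
From mathcomp Require Import all_classical all_reals all_analysis.

Set Implicit Arguments.
Unset Strict Implicit.
Unset Printing Implicit Defensive.

Import Order.TTheory GRing.Theory Num.Theory.
Import numFieldNormedType.Exports.

Local Open Scope classical_set_scope.
Local Open Scope ring_scope.

(* The law of a mean-zero Gaussian process on [0,1] is represented by its
   covariance kernel, which determines it.  Kernels and eigenfunctions are
   total functions on R; only their values on [0,1] are ever used. *)

(* "Positive definite" in the sense of covariance kernels and Mercer's theorem:
   nonnegative quadratic forms. *)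
Definition positive_definite (R : realType) (K : R -> R -> R) : Prop :=
  forall (n : nat) (t c : 'I_n -> R), (forall i, `[0, 1]%classic (t i)) ->
    0 <= \sum_(i < n) \sum_(j < n) c i * c j * K (t i) (t j).

Record covariance_kernel (R : realType) (K : R -> R -> R) : Prop := {
  cov_symmetric : forall s t, `[0, 1]%classic s -> `[0, 1]%classic t ->
    K s t = K t s;
  cov_continuous : {within (`[0, 1] `*` `[0, 1] : set (R * R)%type),
    continuous (fun p : R * R => K p.1 p.2)};
  cov_positive_definite : positive_definite K;
  cov_finite_variance :
    lebesgue_measure.-integrable `[0, 1]%classic (fun t : R => (K t t)%:E) }.

(* [e j] is the eigenfunction attached to the eigenvalue [lam j], indices
   starting at 0.  The expansion of K says that no nonzero eigenvalue (counted
   with multiplicity) is missing from the list; no ordering is imposed here. *)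
Record karhunen_loeve (R : realType) (K : R -> R -> R)
    (lam : nat -> R) (e : nat -> R -> R) : Prop := {
  kl_eigenvalue_ge0 : forall j, 0 <= lam j;
  kl_continuous : forall j, {within `[0, 1]%classic, continuous (e j)};
  kl_orthonormal : forall i j,
    \int[lebesgue_measure]_(t in `[0, 1]%classic) (e i t * e j t) = (i == j)%:R;
  kl_eigen : forall j s, `[0, 1]%classic s ->
    \int[lebesgue_measure]_(t in `[0, 1]%classic) (K s t * e j t)
      = lam j * e j s;
  kl_expansion : forall s t, `[0, 1]%classic s -> `[0, 1]%classic t ->
    series (fun j => lam j * e j s * e j t) @ \oo --> K s t }.

(* [kl_div lamt lam] is D(Q||P) when P and Q have common eigenfunctions, with
   eigenvalues [lam j] (> 0) and [lamt j] on the j-th one.  A term with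
   [lamt j = 0] is -log 0 = +oo: then Q is singular with respect to P. *)
Definition kl_div (R : realType) (lamt lam : nat -> R) : \bar R :=
  ((2^-1)%:E * \sum_(0 <= j <oo)
     (if (0 < lamt j)%R then (lamt j / lam j - 1 - ln (lamt j / lam j))%:E
      else +oo))%E.

(* MathComp-Analysis sets [ln 0 = 0], so a zero eigenvalue contributes 0, as it
   does with the convention log 0 = -oo. *)
Definition water_level (R : realType) (rho : R) (lamt : nat -> R) (mu : R) :
    Prop :=
  0 < mu /\
  ((2^-1)%:E * \sum_(0 <= i <oo) (Num.max 0 (ln (lamt i / mu)))%:E = rho%:E)%E.

(* The set below is finite for summable [lamt] and [mu > 0]. *)
Definition num_attended (R : realType) (lamt : nat -> R) (mu : R) : nat :=
  #|` fset_set [set i : nat | mu < lamt i]|%fset.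

(* n * mu + sum_{i > n} lamt_i; for nonincreasing [lamt], the indices beyond
   the first n are those with [lamt i <= mu]. *)
Definition residual_variance (R : realType) (lamt : nat -> R) (mu : R) :
    \bar R :=
  (((num_attended lamt mu)%:R * mu)%:E
    + \sum_(0 <= i <oo | (lamt i <= mu)%R) (lamt i)%:E)%E.

Definition total_loss (R : realType) (f : R -> R) (lam : nat -> R)
    (eta k : R) (lamt : nat -> R) (mu : R) : \bar R :=
  (((4 * k)^-1)%:E * residual_variance lamt mu
    + (f k / 2)%:E * (\sum_(0 <= i <oo) (lamt i)%:E)
    + eta%:E * kl_div lamt lam)%E.

(* A team size [k] and a process Q, with kernel [Kt] and eigenvalue [lamt j] on
   the baseline eigenfunction [e j].  [mu] is not a free choice: it is
   determined by [lamt] and [rho]. *)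
Definition feasible (R : realType) (rho : R) (e : nat -> R -> R)
    (k : R) (Kt : R -> R -> R) (lamt : nat -> R) (mu : R) : Prop :=
  [/\ 1 <= k, covariance_kernel Kt, karhunen_loeve Kt lamt e
    & water_level rho lamt mu].

Definition optimal_team_size (R : realType) (rho : R) (f : R -> R)
    (lam : nat -> R) (e : nat -> R -> R) (eta k : R) : Prop :=
  exists (Kt : R -> R -> R) (lamt : nat -> R) (mu : R),
    feasible rho e k Kt lamt mu /\
    forall k' Kt' lamt' mu', feasible rho e k' Kt' lamt' mu' ->
      (total_loss f lam eta k lamt mu <= total_loss f lam eta k' lamt' mu')%E.

Definition zero_attention_team_size (R : realType) (f : R -> R) (k0 : R) :
    Prop :=
  1 <= k0 /\
  forall k, 1 <= k -> (4 * k0)^-1 + f k0 / 2 <= (4 * k)^-1 + f k / 2.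

(* Differentiability of a function on the closed half-line [1, +oo): one-sided
   at the endpoint. *)
Definition differentiable_from1 (R : realType) (f : R -> R) : Prop :=
  forall k, 1 <= k ->
    cvg (h^-1 * (f (k + h) - f k)
           @[h --> within [set h : R | 1 <= k + h] (dnbhs 0)]).

(* Main.v *)
(** A posterior variance reduction by the factor [z i = exp (- 2 r_i)] in each
    Karhunen-Loeve direction turns headquarters' problem into a minimum over
    allocations [\sum_i - ln (z i) = 2 rho].  For fixed [k] and [z] the loss is
    minimized over the eigenvalues of Q in closed form, and with [t = 1 / eta],
    [p = f k], [q = 1 / (2 k)] the value is [1 / (2 t)] times the reduced loss
    [\sum_i ln (1 + t * lam i * (p + q * z i))].

    Monotonicity is a single-crossing property in [t] of two points [(p1, q1)]
    and [(p2, q2)] with [p1 < p2] and [q2 < q1].  With water-filling, the load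
    [lam i * (p + q * z i)] is the minimum of two affine functions of [lam i], so
    the loads of two plans cross at most once.  This compares the plans at
    [t2 < t1] directly when [t1 * p1 <= t2 * p2], and a geometric chain of
    intermediate values of [t] removes that restriction.

    As [t] tends to infinity, attention changes the reduced loss by at most
    [2 rho], while the infinitely many eigenvalues make a difference in [p + q]
    count without bound; hence optimal sizes approach the minimum of [p + q],
    which is the criterion without attention. *)

Require Import Defs.
From HB Require Import structures.
From mathcomp Require Import all_boot all_order all_algebra finmap.
From mathcomp Require Import all_classical all_reals all_analysis.
From mathcomp Require Import ring lra.

Import Order.TTheory GRing.Theory Num.Theory.
Import numFieldNormedType.Exports.

Set Implicit Arguments.
Unset Strict Implicit.
Unset Printing Implicit Defensive.

Local Open Scope classical_set_scope.
Local Open Scope ring_scope.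

(** * Logarithms and series *)

Lemma ln_le_sub1 (R : realType) (s : R) : 0 < s -> ln s <= s - 1.
Proof.
by move=> s0; have := @le_ln1Dx R (s - 1); rewrite addrCA subrr addr0; apply; lra.
Qed.

Lemma ln_lt_sub1 (R : realType) (s : R) : 0 < s -> s != 1 -> ln s < s - 1.
Proof.
move=> s0 s1; have l0 : ln s != 0 by rewrite ln_eq0.
by have := expR_gt1Dx l0; rewrite lnK ?posrE//; lra.
Qed.

(** Concavity of [ln] between 1 and [w]: the bound [ln_le_sub1] at [w / v] and at [1 / v], averaged
    with weights [m] and [1 - m], has right-hand side 0. *)
Lemma ln_weighted_amgm (R : realType) (m w : R) : 0 <= m -> m <= 1 -> 0 < w ->
  m * ln w <= ln (1 + m * (w - 1)).
Proof.
move=> m0 m1 w0; set v := 1 + m * (w - 1).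
have v0 : 0 < v.
  rewrite /v; have [m_gt0|m_le0] := ltrP 0 m; first by nra.
  by rewrite (_ : m = 0) ?mul0r ?addr0//; lra.
have := @ln_le_sub1 _ (w / v) (divr_gt0 w0 v0).
have := @ln_le_sub1 _ (1 / v) (divr_gt0 ltr01 v0).
rewrite !ln_div ?posrE// ln1 => h1 h2.
have h3 : m * (w / v - 1) + (1 - m) * (1 / v - 1) = 0.
  by rewrite /v; field; rewrite -/v gt_eqF.
have := ler_wpM2l m0 h2.
have m1' : 0 <= 1 - m by lra.
have := ler_wpM2l m1' h1.
by lra.
Qed.

Lemma ln_weighted_amgm_strict (R : realType) (m w : R) :
  0 < m -> m < 1 -> 0 < w -> w != 1 -> m * ln w < ln (1 + m * (w - 1)).
Proof.
move=> m0 m1 w0 w1; set v := 1 + m * (w - 1).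
have v0 : 0 < v by rewrite /v; nra.
have v1 : 1 / v != 1.
  rewrite div1r invr_eq1 /v -subr_eq0 addrC addKr mulf_eq0 subr_eq0.
  by rewrite negb_or (gt_eqF m0).
have := @ln_le_sub1 _ (w / v) (divr_gt0 w0 v0).
have := @ln_lt_sub1 _ (1 / v) (divr_gt0 ltr01 v0) v1.
rewrite !ln_div ?posrE// ln1 => h1 h2.
have h3 : m * (w / v - 1) + (1 - m) * (1 / v - 1) = 0.
  by rewrite /v; field; rewrite -/v gt_eqF.
have := ler_wpM2l (ltW m0) h2.
have m1' : 0 < 1 - m by lra.
move: h1; rewrite -(ltr_pM2l m1').
by lra.
Qed.

Lemma cvg_series_le (R : realType) (u v : R ^nat) (a b : R) :
  (forall i, u i <= v i) -> series u @ \oo --> a -> series v @ \oo --> b ->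
  a <= b.
Proof.
move=> uv ua vb; apply: (ler_cvg_to ua vb); apply: nearW => n.
exact: ler_sum.
Qed.

Lemma cvg_series_lt (R : realType) (u v : R ^nat) (a b : R) (i0 : nat) :
  (forall i, u i <= v i) -> u i0 < v i0 ->
  series u @ \oo --> a -> series v @ \oo --> b -> a < b.
Proof.
move=> uv uv0 ua vb; rewrite -subr_gt0; apply: (@lt_le_trans _ _ (v i0 - u i0)).
  by rewrite subr_gt0.
have vua : series v \- series u @ \oo --> b - a by exact: cvgB.
rewrite -(cvg_lim _ vua)//; apply: limr_ge; first exact: cvgP vua.
near=> n; rewrite /= /series/= -sumrB.
have i0n : (i0 < n)%N by near: n; exact: nbhs_infty_gt.
rewrite big_mkord (bigD1 (Ordinal i0n))//= lerDl sumr_ge0// => j _.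
by rewrite subr_ge0.
Unshelve. all: by end_near. Qed.

Lemma cvg_seriesD (R : realType) (u v : R ^nat) (a b : R) :
  series u @ \oo --> a -> series v @ \oo --> b ->
  series (fun i => u i + v i) @ \oo --> a + b.
Proof.
move=> ua vb; rewrite (_ : series _ = series u \+ series v); first exact: cvgD.
by apply/funext => n; rewrite /series/= big_split.
Qed.

Lemma cvg_seriesZ (R : realType) (u : R ^nat) (a c : R) :
  series u @ \oo --> a -> series (fun i => c * u i) @ \oo --> c * a.
Proof.
move=> ua; rewrite (_ : series _ = (fun n => c * series u n)).
  exact: cvgMl_tmp.
by apply/funext => n; rewrite /series/= big_distrr.
Qed.

Lemma series_nneseries (R : realType) (u : R ^nat) (a : R) :
  series u @ \oo --> a -> (\sum_(0 <= i <oo) (u i)%:E = a%:E)%E.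
Proof.
move=> ua; rewrite -(cvg_lim _ ua)// -EFin_lim; last exact: cvgP ua.
by apply: congr_lim; apply/funext => n/=; rewrite sumEFin.
Qed.

Lemma nneseries_series (R : realType) (u : R ^nat) (a : R) :
  (forall i, 0 <= u i) -> (\sum_(0 <= i <oo) (u i)%:E = a%:E)%E ->
  series u @ \oo --> a.
Proof.
move=> u0 ua.
have cu : cvgn (series u) by apply: nnseries_is_cvg => //; rewrite ua ltry.
have : series u @ \oo --> limn (series u) by exact: cu.
by move=> /[dup] /series_nneseries; rewrite ua => -[<-].
Qed.

Lemma ge0_series_cvg_le (R : realType) (u v : R ^nat) (b : R) :
  (forall i, 0 <= u i <= v i) -> series v @ \oo --> b ->
  exists a : R, series u @ \oo --> a.
Proof.
move=> uv vb; exists (limn (series u)).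
apply: (@series_le_cvg _ u v) => [i|i|i|]; last exact: cvgP vb.
- by case/andP: (uv i).
- by case/andP: (uv i); apply: le_trans.
- by case/andP: (uv i).
Qed.

(** * Water-filling for the reduced loss *)

Definition allocation (R : realType) (rho : R) (z : R ^nat) : Prop :=
  (forall i, 0 < z i <= 1) /\ series (fun i => - ln (z i)) @ \oo --> 2 * rho.

Definition baseline_spectrum (R : realType) (lam : R ^nat) : Prop :=
  [/\ forall i, 0 < lam i, forall i j : nat, (i <= j)%N -> lam j <= lam i
    & cvgn (series lam)].

Definition reduced_term (R : realType) (lam : R ^nat) (t p q : R) (z : R ^nat) :
    R ^nat :=
  fun i => ln (1 + t * lam i * (p + q * z i)).

Definition reduced_loss (R : realType) (lam : R ^nat) (t p q : R) (z : R ^nat) :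
    R :=
  limn (series (reduced_term lam t p q z)).

(** Dividing [1 + t * lam i * (p + q * z i)] by the factor [1 + t * lam i * p], which attention
    cannot reduce, leaves [t * marginal] as the coefficient of [z i] (see [reduced_termE]). *)
Definition marginal (R : realType) (lam : R ^nat) (t p q : R) : R ^nat :=
  fun i => lam i * q / (1 + t * lam i * p).

(** [n] is a real water level for the values of [marginal], not a number of attended directions. *)
Definition waterfilling (R : realType) (lam : R ^nat) (t p q n : R)
    (z : R ^nat) : Prop :=
  0 < n /\ forall i, z i = Num.min 1 (n / marginal lam t p q i).

Lemma marginal_gt0 (R : realType) (lam : R ^nat) (t p q : R) (i : nat) :
  0 < lam i -> 0 < t -> 0 < p -> 0 < q -> 0 < marginal lam t p q i.
Proof. by move=> *; rewrite divr_gt0 ?mulr_gt0// addr_gt0 ?mulr_gt0. Qed.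

Lemma ge0_ln1D (R : realType) (x : R) : 0 <= x -> 0 <= ln (1 + x) <= x.
Proof. by move=> x0; rewrite ln_ge0 ?lerDl//= le_ln1Dx//; lra. Qed.

Lemma reduced_term_bounds (R : realType) (lam : R ^nat) (t p q : R)
    (z : R ^nat) (i : nat) :
  0 < lam i -> 0 < t -> 0 < p -> 0 < q -> 0 < z i <= 1 ->
  0 <= reduced_term lam t p q z i <= t * (p + q) * lam i.
Proof.
move=> l0 t0 p0 q0 /andP[z0 z1].
have x0 : 0 <= t * lam i * (p + q * z i).
  by rewrite !mulr_ge0// ?addr_ge0 ?mulr_ge0// ltW.
have /andP[-> h] := ge0_ln1D x0; apply: (le_trans h).
rewrite [leRHS]mulrAC; apply: ler_wpM2l; first by rewrite mulr_ge0// ltW.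
by rewrite lerD2l ger_pMr.
Qed.

Lemma cvg_reduced_loss (R : realType) (lam : R ^nat) (t p q : R) (z : R ^nat) :
  baseline_spectrum lam -> 0 < t -> 0 < p -> 0 < q -> (forall i, 0 < z i <= 1) ->
  series (reduced_term lam t p q z) @ \oo --> reduced_loss lam t p q z.
Proof.
move=> [l0 _ cl] t0 p0 q0 z01.
have := cvg_seriesZ (c := t * (p + q)) cl.
move=> /(@ge0_series_cvg_le _ (reduced_term lam t p q z)) [i|a ha].
  exact: reduced_term_bounds.
exact: cvgP ha.
Qed.

(* [m] is the common slope of [ln (1 + t * d * exp u)] at the optimum over the
   indices that receive attention, so this is the supporting line of a convex
   function. *)
Lemma waterfilling_term_min (R : realType) (t d n w z m : R) :
  0 < t -> 0 < d -> 0 < n -> 0 < w <= 1 ->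
  z = Num.min 1 (n / d) -> m = t * n / (1 + t * n) ->
  ln (1 + t * d * z) + m * (- ln z) <= ln (1 + t * d * w) + m * (- ln w).
Proof.
move=> t0 d0 n0 /andP[w0 w1] zE mE.
have tn0 : 0 < t * n by rewrite mulr_gt0.
have td0 : 0 < t * d by rewrite mulr_gt0.
have tdw0 : 0 < t * d * w by rewrite mulr_gt0.
have m0 : 0 < m by rewrite mE divr_gt0// addr_gt0.
have m1 : m <= 1 by rewrite mE ler_pdivrMr ?addr_gt0//; lra.
rewrite zE minEle; case: ifPn => [dn|].
  rewrite ln1 oppr0 mulr0 addr0 mulr1.
  have dn' : d <= n by move: dn; rewrite ler_pdivlMr// mul1r.
  (* Corner case [z = 1]: the slope at [u = 0] is [c <= m] because [d <= n], and replacing [c] by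
     [m] only lowers the bound since [ln w <= 0]. *)
  pose c := t * d / (1 + t * d).
  have c0 : 0 < c by rewrite divr_gt0// addr_gt0.
  have c1 : c <= 1 by rewrite ler_pdivrMr ?addr_gt0//; lra.
  have cm : c <= m.
    rewrite mE ler_pdivrMr ?addr_gt0// mulrAC ler_pdivlMr ?addr_gt0//.
    by have := ler_wpM2l (ltW t0) dn'; lra.
  have := ln_weighted_amgm (ltW c0) c1 w0.
  rewrite (_ : 1 + _ = (1 + t * d * w) / (1 + t * d)); last first.
    by rewrite /c; field; rewrite gt_eqF// addr_gt0.
  rewrite ln_div ?posrE ?addr_gt0// => h.
  have := ler_wnM2r (ln_le0 w1) cm.
  by lra.
rewrite -ltNge ltr_pdivrMr// mul1r => nd.
have nd0 : 0 < n / d by rewrite divr_gt0.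
have := ln_weighted_amgm (ltW m0) m1 (divr_gt0 w0 nd0).
rewrite (_ : 1 + _ = (1 + t * d * w) / (1 + t * n)); last first.
  by rewrite mE; field; rewrite !gt_eqF// addr_gt0.
rewrite !ln_div ?posrE ?addr_gt0// (_ : t * d * (n / d) = t * n); last first.
  by field; rewrite gt_eqF.
rewrite -ln_div ?posrE// mulrBr.
by lra.
Qed.

Lemma reduced_termE (R : realType) (lam : R ^nat) (t p q : R) (z : R ^nat)
    (i : nat) :
  0 < lam i -> 0 < t -> 0 < p -> 0 < q -> 0 < z i ->
  reduced_term lam t p q z i =
  ln (1 + t * lam i * p) + ln (1 + t * marginal lam t p q i * z i).
Proof.
move=> l0 t0 p0 q0 z0; have a0 : 0 < 1 + t * lam i * p.
  by rewrite addr_gt0// !mulr_gt0.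
have d0 : 0 < marginal lam t p q i by exact: marginal_gt0.
have b0 : 0 < 1 + t * marginal lam t p q i * z i.
  by rewrite addr_gt0// (mulr_gt0 (mulr_gt0 t0 d0)).
rewrite -lnM ?posrE//.
by congr ln; rewrite /marginal; field; rewrite gt_eqF.
Qed.

(** Lagrangian argument: both allocations have total [2 * rho], so adding [m] times this total to
    each side is harmless and reduces the claim to a termwise one with the common multiplier [m]. *)
Lemma waterfilling_min (R : realType) (lam : R ^nat) (rho t p q n : R)
    (z w : R ^nat) :
  baseline_spectrum lam -> 0 < t -> 0 < p -> 0 < q ->
  waterfilling lam t p q n z -> allocation rho z -> allocation rho w ->
  reduced_loss lam t p q z <= reduced_loss lam t p q w.
Proof.
move=> hl t0 p0 q0 [n0 zE] [z01 hz] [w01 hw]; have [l0 _ _] := hl.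
pose m := t * n / (1 + t * n).
have cz := cvg_seriesD (cvg_reduced_loss hl t0 p0 q0 z01) (cvg_seriesZ (c := m) hz).
have cw := cvg_seriesD (cvg_reduced_loss hl t0 p0 q0 w01) (cvg_seriesZ (c := m) hw).
rewrite -(lerD2r (m * (2 * rho))); apply: cvg_series_le cz cw => i.
have [/andP[z0 _] /andP[w0 _]] := (z01 i, w01 i).
rewrite !reduced_termE// -!addrA lerD2l.
exact: waterfilling_term_min (marginal_gt0 _ _ _ _) _ _ (zE i) _.
Qed.

Lemma marginal_le (R : realType) (lam : R ^nat) (t p q : R) (i j : nat) :
  0 < lam i -> lam i <= lam j -> 0 < t -> 0 < p -> 0 < q ->
  marginal lam t p q i <= marginal lam t p q j.
Proof.
move=> l0 lij t0 p0 q0; have lj0 : 0 < lam j := lt_le_trans l0 lij.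
rewrite /marginal ler_pdivrMr; last by rewrite addr_gt0// !mulr_gt0.
rewrite mulrAC ler_pdivlMr; last by rewrite addr_gt0// !mulr_gt0.
have := ler_wpM2r (ltW q0) lij; lra.
Qed.

Lemma marginal_leM (R : realType) (lam : R ^nat) (t p q : R) (i : nat) :
  0 < lam i -> 0 < t -> 0 < p -> 0 < q -> marginal lam t p q i <= lam i * q.
Proof.
move=> l0 t0 p0 q0; rewrite /marginal ler_pdivrMr; last first.
  by rewrite addr_gt0// !mulr_gt0.
by rewrite ler_peMr ?lerDl// !mulr_ge0// ltW.
Qed.

(** Intermediate value theorem for the total of the [- ln (z i)] as a function of the level. *)
Lemma waterfilling_exists (R : realType) (lam : R ^nat) (rho t p q : R) :
  baseline_spectrum lam -> 0 < rho -> 0 < t -> 0 < p -> 0 < q ->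
  exists (n : R) (z : R ^nat), waterfilling lam t p q n z /\ allocation rho z.
Proof.
move=> [l0 lni cl] rho0 t0 p0 q0; pose d := marginal lam t p q.
have d0 i : 0 < d i by exact: marginal_gt0.
have dni i : d i <= d 0%N by exact: marginal_le (lni _ _ _) _ _ _.
(* At level [lo] direction 0 alone absorbs the budget [2 * rho]; at level [d 0] no direction
   receives any. *)
pose lo := d 0%N * expR (- (2 * rho)).
have lo0 : 0 < lo by rewrite mulr_gt0// expR_gt0.
have lohi : lo <= d 0%N by rewrite ger_pMr// -[leRHS]expR0 ler_expR; lra.
have [N _ dN] : \forall i \near \oo, d i <= lo.
  have /cvgr0Pnorm_lt := cvg_series_cvg_0 cl.
  move=> /(_ (lo / q) (divr_gt0 lo0 q0)); apply: filterS => i.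
  rewrite gtr0_norm// ltr_pdivlMr// => /ltW.
  exact/le_trans/marginal_leM.
pose F (m : nat) (n : R) := \sum_(0 <= i < m) Num.max 0 (ln (d i) - ln n).
have Fc m : {within `[lo, d 0%N], continuous (F m)}.
  apply: continuous_in_subspaceT => x; rewrite inE/= in_itv/= => /andP[lox _].
  rewrite /F; elim: m => [|m IH].
    rewrite (_ : (fun _ => _) = cst 0); first exact: cvg_cst.
    by apply/funext => y; rewrite big_geq.
  rewrite (_ : (fun _ => _) = (fun n => \sum_(0 <= i < m)
    Num.max 0 (ln (d i) - ln n) + Num.max 0 (ln (d m) - ln n))); last first.
    by apply/funext => y; rewrite big_nat_recr.
  apply: cvgD; first exact: IH.
  apply: (@continuous_max _ _ (cst 0) (fun n => ln (d m) - ln n)).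
    exact: cvg_cst.
  apply: cvgB; first exact: cvg_cst.
  exact/continuous_ln/(lt_le_trans lo0).
have Fmono m (x y : R) : 0 < x -> x <= y -> F m y <= F m x.
  move=> x0 xy; apply: ler_sum => i _; rewrite ge_max le_max lexx/= le_max.
  by rewrite lerD2l lerN2 ler_ln ?posrE ?xy ?orbT//; exact: lt_le_trans xy.
have Fhi m : F m (d 0%N) = 0.
  rewrite /F big1// => i _; apply/max_idPl; rewrite subr_le0 ler_ln ?posrE//.
(* [N.+1] instead of [N] keeps direction 0 in the sum even when [N = 0]. *)
have Flo : 2 * rho <= F N.+1 lo.
  rewrite /F big_nat_recl//= (le_trans _ (_ : Num.max 0 (ln (d 0%N) - ln lo) <= _))//.
    rewrite le_max /lo lnM ?posrE ?expR_gt0// expRK; apply/orP; right; lra.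
  by rewrite lerDl sumr_ge0// => i _; rewrite le_max lexx.
have [|n nin Fn] := @IVT R (F N.+1) lo (d 0%N) (2 * rho) lohi (Fc N.+1).
  by rewrite Fhi ge_min le_max Flo/= mulr_ge0 ?orbT// ltW.
move: nin; rewrite in_itv/= => /andP[lon nhi].
have n0 : 0 < n := lt_le_trans lo0 lon.
exists n, (fun i => Num.min 1 (n / d i)); split; first by split.
have zE i : - ln (Num.min 1 (n / d i)) = Num.max 0 (ln (d i) - ln n).
  have e : ln (d i) - ln n = - ln (n / d i).
    by rewrite [in RHS]ln_div ?posrE// opprB.
  rewrite e minEle; case: ifPn => [h|].
    by rewrite ln1 oppr0; apply/esym/max_idPl; rewrite oppr_le0 ln_ge0.
  rewrite -ltNge => /ltW h; apply/esym/max_idPr.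
  by rewrite oppr_ge0 ln_le0.
split=> [i|]; first by rewrite ge_min lexx lt_min ltr01 divr_gt0.
apply: cvg_near_cst; near=> m.
rewrite /series/= (eq_bigr _ (fun i _ => zE i)) -Fn -/(F m n) /F.
have Nm : (N.+1 <= m)%N by near: m; exact: nbhs_infty_ge.
rewrite (big_cat_nat (n := N.+1))//= -[RHS]addr0; congr (_ + _).
rewrite big_nat; apply: big1 => i /andP[Ni _]; apply/max_idPl.
rewrite subr_le0 ler_ln ?posrE//.
by apply: le_trans lon; apply: dN => /=; exact: ltnW.
Unshelve. all: by end_near. Qed.

(** * Single crossing *)

(** Since [n / marginal] times [lam i * q] is [n * (1 + t * lam i * p)], the load is affine in the
    eigenvalue with intercept [n] in attended directions, and proportional to it in the others. *)
Lemma waterfilling_loadE (R : realType) (lam : R ^nat) (t p q n : R)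
    (z : R ^nat) (i : nat) :
  0 < lam i -> 0 < t -> 0 < p -> 0 < q -> waterfilling lam t p q n z ->
  lam i * (p + q * z i) =
  Num.min (n + (1 + t * n) * p * lam i) (lam i * (p + q)).
Proof.
move=> l0 t0 p0 q0 [n0 ->].
have a0 : 0 < 1 + t * lam i * p by rewrite addr_gt0// !mulr_gt0.
have d0 : 0 < marginal lam t p q i by exact: marginal_gt0.
have lq0 : 0 < lam i * q by rewrite mulr_gt0.
have e : n / marginal lam t p q i * (lam i * q) = n * (1 + t * lam i * p).
  by rewrite /marginal; field; rewrite !gt_eqF.
rewrite (_ : lam i * _ = lam i * p +
    Num.min 1 (n / marginal lam t p q i) * (lam i * q)); last by ring.
rewrite minr_pMl ?(ltW lq0)// e addr_minr mul1r minC.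
by congr Num.min; ring.
Qed.

(** Since [x * b2 < x * b1], the minimum of plan 1 at [x] must be its first branch, which lies below
    both branches of plan 2. The intercept [n1] exceeds both [n2] and 0, so the slope [a1] is below
    [a2] and [b2], and the inequalities persist to the right. *)
Lemma single_crossing (R : realType) (n1 n2 a1 a2 b1 b2 x y : R) :
  0 < n1 -> n2 < n1 -> b2 < b1 -> 0 < x -> x <= y ->
  Num.min (n1 + a1 * x) (x * b1) < Num.min (n2 + a2 * x) (x * b2) ->
  Num.min (n1 + a1 * y) (y * b1) < Num.min (n2 + a2 * y) (y * b2).
Proof.
move=> n10 n21 b21 x0 xy; rewrite !lt_min !gt_min => /andP[h1 h2].
have b21x : x * b2 < x * b1 by rewrite ltr_pM2l.
have h2' : n1 + a1 * x < x * b2.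
  by case/orP: h2 => // h; move: (lt_trans h b21x); rewrite ltxx.
have h1' : n1 + a1 * x < n2 + a2 * x.
  case/orP: h1 => // h; apply: lt_trans h; exact: lt_trans b21x.
have a12 : a1 < a2 by rewrite -(ltr_pM2r x0); lra.
have a1b : a1 < b2 by rewrite -(ltr_pM2r x0); lra.
apply/andP; split; apply/orP; left.
  have := ler_wpM2l (_ : 0 <= a2 - a1) xy; rewrite subr_ge0 => /(_ (ltW a12)).
  lra.
have := ler_wpM2l (_ : 0 <= b2 - a1) xy; rewrite subr_ge0 => /(_ (ltW a1b)).
lra.
Qed.

Lemma allocation_lt1 (R : realType) (rho : R) (z : R ^nat) :
  0 < rho -> allocation rho z -> exists i, z i < 1.
Proof.
move=> rho0 [z01 hz]; apply/not_existsP => h.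
have z1 i : z i = 1.
  apply/le_anti; have /andP[_ ->] := z01 i.
  by rewrite leNgt; apply/negP/h.
have e : series (fun i => - ln (z i)) @ \oo --> (0 : R).
  rewrite (_ : series _ = cst 0); first exact: cvg_cst.
  by apply/funext => n; rewrite /series/= big1// => i _; rewrite z1 ln1 oppr0.
have := cvg_unique (@Rhausdorff R) hz e.
by move=> h0; move: rho0; rewrite -(pmulr_rgt0 _ (ltr0n _ 2)) h0 ltxx.
Qed.

(** Every marginal of plan 2 is smaller than that of plan 1, so spending the same budget requires a
    lower level. *)
Lemma waterfilling_level_lt (R : realType) (lam : R ^nat)
    (rho t1 p1 q1 n1 t2 p2 q2 n2 : R) (z1 z2 : R ^nat) :
  (forall i, 0 < lam i) -> 0 < rho ->
  0 < t1 -> 0 < p1 -> 0 < q1 -> 0 < t2 -> 0 < p2 -> 0 < q2 ->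
  t1 * p1 <= t2 * p2 -> q2 < q1 ->
  waterfilling lam t1 p1 q1 n1 z1 -> waterfilling lam t2 p2 q2 n2 z2 ->
  allocation rho z1 -> allocation rho z2 -> n2 < n1.
Proof.
move=> l0 rho0 t10 p10 q10 t20 p20 q20 tp q21 [n10 z1E] [n20 z2E] a1 a2.
rewrite ltNge; apply/negP => n12.
pose d1 := marginal lam t1 p1 q1; pose d2 := marginal lam t2 p2 q2.
have d10 i : 0 < d1 i by exact: marginal_gt0.
have d20 i : 0 < d2 i by exact: marginal_gt0.
have d21 i : d2 i < d1 i.
  rewrite /d1 /d2 /marginal ltr_pdivrMr; last by rewrite addr_gt0// !mulr_gt0.
  rewrite mulrAC ltr_pdivlMr; last by rewrite addr_gt0// !mulr_gt0.
  rewrite -!mulrA ltr_pM2l//.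
  have := ler_wpM2l (ltW (l0 i)) tp => h.
  have g : q2 * (1 + lam i * (t1 * p1)) < q1 * (1 + lam i * (t1 * p1)).
    by rewrite ltr_pM2r// addr_gt0// !mulr_gt0.
  have := ler_wpM2l (ltW q10) h; lra.
have nd i : n1 / d1 i < n2 / d2 i.
  apply: (@lt_le_trans _ _ (n1 / d2 i)); last by rewrite ler_pM2r ?invr_gt0.
  by rewrite ltr_pM2l// ltf_pV2 ?posrE.
have [i z2i] := allocation_lt1 rho0 a2.
have [[z101 c1] [z201 c2]] := (a1, a2).
have zle j : - ln (z2 j) <= - ln (z1 j).
  rewrite lerN2 ler_ln ?posrE; try by [case/andP: (z101 j)|case/andP: (z201 j)].
  by rewrite z1E z2E le_min !ge_min lexx/= (ltW (nd j)) orbT.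
have : 2 * rho < 2 * rho; last by rewrite ltxx.
apply: (@cvg_series_lt _ _ _ _ _ i zle _ c2 c1).
rewrite ltrN2 ltr_ln ?posrE; try by [case/andP: (z101 i)|case/andP: (z201 i)].
move: z2i; rewrite !z2E gt_min ltxx/= => h.
by rewrite z1E lt_min !gt_min (nd i) (lt_trans (nd i) h) !orbT.
Qed.

(** [m] is the ratio at [xi] of the derivatives of [ln (1 + s * y)] and [ln (1 + t * y)]. This ratio
    increases with [y] because [s < t]: moving up above [xi] gains at least the factor [m], and
    moving down below [xi] loses at most that factor. *)
Lemma ln_scale_compare (R : realType) (s t xi a b : R) :
  0 < s -> s < t -> 0 <= xi -> 0 <= a -> 0 <= b ->
  (b <= a <= xi) || (xi <= a <= b) ->
  let m := s * (1 + t * xi) / (t * (1 + s * xi)) in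
  (m * (ln (1 + t * b) - ln (1 + t * a)) <= ln (1 + s * b) - ln (1 + s * a)) /\
  (a != b ->
   m * (ln (1 + t * b) - ln (1 + t * a)) < ln (1 + s * b) - ln (1 + s * a)).
Proof.
move=> s0 st xi0 a0 b0 abxi m; have t0 : 0 < t := lt_trans s0 st.
have g (r y : R) : 0 < r -> 0 <= y -> 0 < 1 + r * y.
  by move=> r0 y0; rewrite (lt_le_trans ltr01)// lerDl mulr_ge0// ltW.
have [[gtx gsx] gta] := (g t xi t0 xi0, g s xi s0 xi0, g t a t0 a0).
have [[gtb gsa] gsb] := (g t b t0 b0, g s a s0 a0, g s b s0 b0).
have m0 : 0 < m by rewrite divr_gt0 ?mulr_gt0.
have m1 : m < 1 by rewrite ltr_pdivrMr ?mulr_gt0//; lra.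
pose w := (1 + t * b) / (1 + t * a).
have w0 : 0 < w by rewrite divr_gt0.
have v0 : 0 < 1 + m * (w - 1) by have := @ler_wpM2l R; nra.
(* After [ln_weighted_amgm] only a rational inequality is left; its gap has the sign of
   [(b - a) * (a - xi)], nonnegative in both orderings. *)
have key : 1 + m * (w - 1) <= (1 + s * b) / (1 + s * a).
  rewrite -subr_ge0 (_ : _ - _ = (b - a) * (a - xi) *
    (s * (t - s) / ((1 + s * xi) * (1 + t * a) * (1 + s * a)))); last first.
    by rewrite /m /w; field; rewrite !gt_eqF.
  apply: mulr_ge0; last first.
    by rewrite ltW// divr_gt0 ?mulr_gt0 ?subr_gt0.
  case/orP: abxi => /andP[h1 h2]; last by rewrite mulr_ge0 ?subr_ge0.
  by rewrite mulr_le0 ?subr_le0.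
have key' : ln (1 + m * (w - 1)) <= ln (1 + s * b) - ln (1 + s * a).
  by rewrite -ln_div ?posrE// ler_ln ?posrE// divr_gt0.
rewrite -[in X in X /\ _]ln_div ?posrE// -/w; split.
  by apply: le_trans key'; apply: ln_weighted_amgm => //; exact: ltW.
move=> ab; rewrite -[in ltLHS]ln_div ?posrE// -/w.
apply: lt_le_trans key'; apply: ln_weighted_amgm_strict => //.
rewrite /w -subr_eq0 (_ : _ - 1 = (b - a) * (t / (1 + t * a))); last first.
  by field; rewrite gt_eqF.
apply: mulf_neq0; first by rewrite subr_eq0 eq_sym.
by rewrite gt_eqF// divr_gt0.
Qed.

(* The loads [lam i * (p + q * z i)] of the two plans, at [t1] and at [t2],
   cross at most once, from above to below, as the eigenvalue grows.  Above the
   crossing value [xi] passing from [t1] to [t2] shrinks log differences less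
   than below it, and [m] is the shrinking factor at [xi]. *)
Lemma reduced_loss_step (R : realType) (lam : R ^nat)
    (rho t1 t2 p1 p2 q1 q2 n1 n2 : R) (z1 z2 : R ^nat) :
  baseline_spectrum lam -> 0 < rho -> 0 < t2 -> t2 < t1 ->
  0 < p1 -> p1 < p2 -> 0 < q2 -> q2 < q1 -> t1 * p1 <= t2 * p2 ->
  waterfilling lam t1 p1 q1 n1 z1 -> allocation rho z1 ->
  waterfilling lam t2 p2 q2 n2 z2 -> allocation rho z2 ->
  reduced_loss lam t1 p1 q1 z1 <= reduced_loss lam t1 p2 q2 z2 ->
  exists w, allocation rho w /\
    reduced_loss lam t2 p1 q1 w < reduced_loss lam t2 p2 q2 z2.
Proof.
move=> hl rho0 t20 t21 p10 p12 q20 q21 tp w1 a1 w2 a2 hle.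
have [l0 lni cl] := hl; have [z101 c1] := a1; have [z201 c2] := a2.
have t10 : 0 < t1 := lt_trans t20 t21.
have p20 : 0 < p2 := lt_trans p10 p12.
have q10 : 0 < q1 := lt_trans q20 q21.
(* If plan 1 is no worse without attention, then using [z2] for plan 1 makes all its loads at most
   those of plan 2, because [q2 < q1] and [z2 <= 1]. *)
have [hs|hs] := leP (p1 + q1) (p2 + q2).
  exists z2; split => //; have [i z2i] := allocation_lt1 rho0 a2.
  have pos (t p q : R) j : 0 < t -> 0 < p -> 0 < q ->
      0 < 1 + t * lam j * (p + q * z2 j).
    move=> t0 p0 q0; have /andP[zj _] := z201 j.
    by rewrite addr_gt0// !mulr_gt0// addr_gt0// mulr_gt0.
  apply: (@cvg_series_lt _ _ _ _ _ i _ _ (cvg_reduced_loss hl t20 p10 q10 z201)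
    (cvg_reduced_loss hl t20 p20 q20 z201)).
    move=> j; rewrite ler_ln ?posrE ?pos// lerD2l ler_pM2l ?mulr_gt0//.
    have /andP[_ zj] := z201 j.
    have := mulr_ge0 (_ : 0 <= q1 - q2) (_ : 0 <= 1 - z2 j).
    by rewrite !subr_ge0 => /(_ (ltW q21) zj); lra.
  rewrite ltr_ln ?posrE ?pos// ltrD2l ltr_pM2l ?mulr_gt0//.
  have := mulr_gt0 (_ : 0 < q1 - q2) (_ : 0 < 1 - z2 i).
  by rewrite !subr_gt0 => /(_ q21 z2i); lra.
exists z1; split => //.
pose y1 i := lam i * (p1 + q1 * z1 i); pose y2 i := lam i * (p2 + q2 * z2 i).
have y10 i : 0 < y1 i.
  by have /andP[? _] := z101 i; rewrite mulr_gt0// addr_gt0// mulr_gt0.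
have y20 i : 0 < y2 i.
  by have /andP[? _] := z201 i; rewrite mulr_gt0// addr_gt0// mulr_gt0.
have y1E i := waterfilling_loadE (l0 i) t10 p10 q10 w1.
have y2E i := waterfilling_loadE (l0 i) t20 p20 q20 w2.
have n21 : n2 < n1.
  by apply: waterfilling_level_lt tp q21 w1 w2 a1 a2.
have n10 : 0 < n1 by case: w1.
have cross i j : lam i <= lam j -> y1 i < y2 i -> y1 j < y2 j.
  by rewrite /y1 /y2 !y1E !y2E; apply: single_crossing.
have y1mono i j : lam i <= lam j -> y1 i <= y1 j.
  move=> lij; rewrite /y1 !y1E le_min !ge_min; apply/andP; split; apply/orP.
    left; rewrite lerD2l ler_wpM2l// mulr_ge0 ?addr_ge0 ?mulr_ge0//; exact: ltW.
  by right; rewrite ler_wpM2r// addr_ge0// ltW.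
(* The crossing value [xi] is [sup S]: loads of plan 1 lie below it where plan 1 has the larger
   load, and above it elsewhere. *)
pose S := [set y1 j | j in [set j | y2 j <= y1 j]].
(* A direction with an eigenvalue so small that plan 1 leaves it unattended. It makes [S] nonempty
   and later gives the strict inequality. *)
have [k hk] : exists k, y2 k < y1 k.
  have /cvgr0Pnorm_lt := cvg_series_cvg_0 cl.
  move=> /(_ (n1 / q1) (divr_gt0 n10 q10))[k _ /(_ k (leqnn k))].
  rewrite gtr0_norm// ltr_pdivlMr// => lkq; exists k.
  have z1k : z1 k = 1.
    case: w1 => _ ->; apply/min_idPl; rewrite ler_pdivlMr ?marginal_gt0// mul1r.
    apply: le_trans (ltW lkq); exact: marginal_leM.
  rewrite /y1 /y2 ltr_pM2l// z1k mulr1; apply: le_lt_trans hs.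
  by rewrite lerD2l ger_pMr//; case/andP: (z201 k).
have hS : has_sup S.
  split; first by exists (y1 k), k => //=; exact: ltW.
  by exists (y1 0%N) => _ [j _ <-]; exact: y1mono (lni _ _ _).
have above j : y2 j <= y1 j -> y1 j <= sup S.
  by move=> h; apply: ub_le_sup; [case: hS|exists j].
have below i : y1 i < y2 i -> sup S <= y1 i.
  move=> h; apply: ge_sup; first by case: hS.
  move=> _ [j /= hj <-]; apply: y1mono; rewrite leNgt; apply/negP => lij.
  by have := cross _ _ (ltW lij) h; rewrite ltNge hj.
have xi0 : 0 <= sup S by apply: le_trans (above k (ltW hk)); exact: ltW.
pose m := t2 * (1 + t1 * sup S) / (t1 * (1 + t2 * sup S)).
have cmp i : (y2 i <= y1 i <= sup S) || (sup S <= y1 i <= y2 i).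
  have [h|h] := leP (y2 i) (y1 i); first by rewrite above.
  by rewrite (ltW h) below.
have h1 := cvg_reduced_loss hl t20 p10 q10 z101.
have h2 := cvg_reduced_loss hl t20 p20 q20 z201.
have g1 := cvg_seriesZ (c := m) (cvg_reduced_loss hl t10 p10 q10 z101).
have g2 := cvg_seriesZ (c := m) (cvg_reduced_loss hl t10 p20 q20 z201).
have m0 : 0 <= m.
  by rewrite divr_ge0 ?mulr_ge0 ?addr_ge0 ?mulr_ge0// ltW.
suff : m * reduced_loss lam t1 p2 q2 z2 + reduced_loss lam t2 p1 q1 z1 <
       reduced_loss lam t2 p2 q2 z2 + m * reduced_loss lam t1 p1 q1 z1.
  by have := ler_wpM2l m0 hle; lra.
have E (t p q : R) z i : reduced_term lam t p q z i =
    ln (1 + t * (lam i * (p + q * z i))) by rewrite /reduced_term mulrA.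
apply: (@cvg_series_lt _ _ _ _ _ k _ _ (cvg_seriesD g2 h1) (cvg_seriesD h2 g1)).
  move=> i /=; rewrite !E -/(y1 i) -/(y2 i).
  have [+ _] := ln_scale_compare t20 t21 xi0 (ltW (y10 i)) (ltW (y20 i)) (cmp i).
  by rewrite -/m; lra.
rewrite /= !E -/(y1 k) -/(y2 k).
have [_] := ln_scale_compare t20 t21 xi0 (ltW (y10 k)) (ltW (y20 k)) (cmp k).
by rewrite gt_eqF// => /(_ isT); rewrite -/m; lra.
Qed.

(** * Optimal sizes for the reduced loss *)

Definition reduced_optimal (R : realType) (lam : R ^nat) (rho : R) (f : R -> R)
    (t k : R) : Prop :=
  1 <= k /\ exists (n : R) (z : R ^nat),
  [/\ waterfilling lam t (f k) (2 * k)^-1 n z, allocation rho z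
    & forall k' w, 1 <= k' -> allocation rho w ->
      reduced_loss lam t (f k) (2 * k)^-1 z <=
      reduced_loss lam t (f k') (2 * k')^-1 w].

(** If [k1 < k2], the advantage of [k1] at [t1] is carried down by [reduced_loss_step] to [t2],
    where it becomes strict and contradicts the optimality of [k2]. *)
Lemma reduced_optimal_monotone (R : realType) (lam : R ^nat) (rho : R)
    (f : R -> R) (t1 t2 k1 k2 : R) :
  baseline_spectrum lam -> 0 < rho -> (forall k, 1 <= k -> 0 < f k) ->
  (forall x y, 1 <= x -> x < y -> f x < f y) -> 0 < t2 -> t2 < t1 ->
  reduced_optimal lam rho f t1 k1 -> reduced_optimal lam rho f t2 k2 ->
  k2 <= k1.
Proof.
move=> hl rho0 f0 fi t20 t21 [k11 [n1 [z1 [w1 a1 o1]]]].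
move=> [k21 [n2 [z2 [w2 a2 o2]]]]; rewrite leNgt; apply/negP => k12.
have t10 : 0 < t1 := lt_trans t20 t21.
pose p1 := f k1; pose p2 := f k2; pose q1 := (2 * k1)^-1; pose q2 := (2 * k2)^-1.
have p10 : 0 < p1 by exact: f0.
have p12 : p1 < p2 by exact: fi.
have p20 : 0 < p2 by exact: f0.
have q20 : 0 < q2 by rewrite invr_gt0; lra.
have q21 : q2 < q1 by rewrite ltf_pV2 ?posrE; lra.
have q10 : 0 < q1 := lt_trans q20 q21.
pose r := p1 / p2.
have r0 : 0 < r by rewrite divr_gt0.
have r1 : r < 1 by rewrite ltr_pdivrMr// mul1r.
(* A step from [s] only reaches down to [r * s]: iterate geometrically. *)
have H j t : 0 < t -> t1 * r ^+ j <= t -> t < t1 ->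
    forall n n' z z', waterfilling lam t p1 q1 n z -> allocation rho z ->
    waterfilling lam t p2 q2 n' z' -> allocation rho z' ->
    reduced_loss lam t p1 q1 z < reduced_loss lam t p2 q2 z'.
  elim: j t => [|j IH] t t0 tj tt1 n n' z z' wz az wz' az'.
    by move: tj; rewrite expr0 mulr1 leNgt tt1.
  (* The largest starting point up to [t1] that satisfies the condition [s * p1 <= t * p2] of
     [reduced_loss_step]. *)
  pose s := Num.min t1 (t / r).
  have ts : t < s by rewrite lt_min tt1 ltr_pdivlMr// gtr_pMr.
  have s0 : 0 < s := lt_trans t0 ts.
  have [m [u [wu au]]] := waterfilling_exists hl rho0 s0 p10 q10.
  have [m' [u' [wu' au']]] := waterfilling_exists hl rho0 s0 p20 q20.
  have hs : reduced_loss lam s p1 q1 u <= reduced_loss lam s p2 q2 u'.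
    have [st1|st1] := ltP s t1.
      apply/ltW; apply: (IH s s0 _ st1 _ _ _ _ wu au wu' au').
      rewrite le_min ler_pdivlMr// -mulrA -exprSr tj andbT ger_pMr//.
      by rewrite exprn_ile1// ltW.
    have e : s = t1 by apply/le_anti; rewrite st1 ge_min lexx.
    rewrite e in wu wu' *; apply: (le_trans (waterfilling_min hl _ _ _ wu au a1)) => //.
    exact: o1.
  have sp : s * p1 <= t * p2.
    apply: (@le_trans _ _ (t / r * p1)).
      by rewrite ler_pM2r// ge_min lexx orbT.
    by rewrite /r le_eqVlt; apply/orP; left; apply/eqP; field; rewrite !gt_eqF//.
  have hs' := le_trans hs (waterfilling_min hl s0 p20 q20 wu' au' az').
  have [w [aw]] :=
    reduced_loss_step hl rho0 t0 ts p10 p12 q20 q21 sp wu au wz' az' hs'.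
  exact: le_lt_trans (waterfilling_min hl t0 p10 q10 wz az aw).
have [j hj] : exists j, t1 * r ^+ j <= t2.
  have /cvgr0Pnorm_lt : (GRing.exp r : R ^nat) @ \oo --> 0.
    by apply: cvg_expr; rewrite gtr0_norm.
  move=> /(_ (t2 / t1) (divr_gt0 t20 t10))[j _ /(_ j (leqnn j))].
  by rewrite gtr0_norm ?exprn_gt0// ltr_pdivlMr// mulrC => /ltW; exists j.
have [n [z [wz az]]] := waterfilling_exists hl rho0 t20 p10 q10.
have := H j t2 t20 hj t21 _ _ _ _ wz az w2 a2.
by rewrite ltNge o2.
Qed.

Definition continuous_from1 (R : realType) (f : R -> R) : Prop :=
  forall k e, 1 <= k -> 0 < e -> exists2 d, 0 < d &
    forall x, 1 <= x -> `|x - k| < d -> `|f x - f k| < e.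

Lemma differentiable_from1_continuous (R : realType) (f : R -> R) :
  differentiable_from1 f -> continuous_from1 f.
Proof.
move=> df k e k1 e0; have /cvg_ex[/= l /cvgrPdist_lt /(_ 1 ltr01)] := df k k1.
rewrite near_withinE near_withinE => /nbhs_ballP[d /= d0 hd].
(* Near [k] the difference quotient is within 1 of its limit [l], hence bounded by this constant. *)
have l0 : 0 < `|l| + 1 by rewrite ltr_pwDr.
exists (Num.min d (e / (`|l| + 1))); first by rewrite lt_min d0 divr_gt0.
move=> x x1; rewrite lt_min => /andP[xd xe].
have [->|xk] := eqVneq x k; first by rewrite subrr normr0.
have xk0 : x - k != 0 by rewrite subr_eq0.
have := hd (x - k); rewrite /ball/= sub0r normrN addrCA subrr addr0.
move=> /(_ xd xk0 x1) h.
have : `|(x - k)^-1 * (f x - f k)| < `|l| + 1.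
  rewrite -[X in `|X|](addrNK l) (le_lt_trans (ler_normD _ _))// addrC ltrD2l.
  by rewrite distrC.
rewrite normrM normfV mulrC ltr_pdivrMr ?normr_gt0// => /lt_le_trans; apply.
by rewrite mulrC -ler_pdivlMr// ltW.
Qed.

Lemma continuous_from1_within (R : realType) (f : R -> R) (M : R) :
  continuous_from1 f -> {within `[1, M], continuous f}.
Proof.
move=> cf; apply/subspace_continuousP => k; rewrite /= in_itv/= => /andP[k1 _].
apply/cvgrPdist_lt => e e0; have [d d0 hd] := cf k e k1 e0.
rewrite near_withinE; apply/nbhs_ballP; exists d => //= x.
rewrite /ball/= distrC => xk; rewrite in_itv/= => /andP[x1 _].
by rewrite distrC; exact: hd.
Qed.

Lemma ln1D_dist (R : realType) (a b : R) :
  0 <= a -> 0 <= b -> ln (1 + b) <= ln (1 + a) + `|b - a|.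
Proof.
move=> a0 b0; have [A0 B0] : 0 < 1 + a /\ 0 < 1 + b by lra.
rewrite -lerBlDl -ln_div ?posrE//.
apply: (le_trans (ln_le_sub1 (divr_gt0 B0 A0))).
rewrite (_ : _ - 1 = (b - a) / (1 + a)); last by field; rewrite gt_eqF.
rewrite ler_pdivrMr//; apply: le_trans (ler_norm _) _.
by rewrite ler_peMr//; lra.
Qed.

(** [ln (1 + y)] is 1-Lipschitz for [y >= 0], and [z i <= 1]. The bound does not depend on [z], so
    it passes to the value function of the team size. *)
Lemma reduced_loss_lipschitz (R : realType) (lam : R ^nat)
    (t p q p' q' : R) (z : R ^nat) :
  baseline_spectrum lam -> 0 < t -> 0 < p -> 0 < q -> 0 < p' -> 0 < q' ->
  (forall i, 0 < z i <= 1) ->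
  reduced_loss lam t p' q' z <= reduced_loss lam t p q z
    + t * (`|p' - p| + `|q' - q|) * limn (series lam).
Proof.
move=> hl t0 p0 q0 p'0 q'0 z01; have [l0 _ cl] := hl.
have cl' : series lam @ \oo --> limn (series lam) by exact: cl.
apply: (cvg_series_le _ (cvg_reduced_loss hl t0 p'0 q'0 z01)
  (cvg_seriesD (cvg_reduced_loss hl t0 p0 q0 z01) (cvg_seriesZ cl'))) => i.
have /andP[zi0 zi1] := z01 i.
have tl0 : 0 < t * lam i by rewrite mulr_gt0.
have pos x y : 0 < x -> 0 < y -> 0 <= t * lam i * (x + y * z i).
  by move=> x0 y0; rewrite !mulr_ge0 ?addr_ge0 ?mulr_ge0// ltW.
apply: (le_trans (ln1D_dist (pos p q p0 q0) (pos p' q' p'0 q'0))).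
rewrite lerD2l -mulrBr normrM gtr0_norm// mulrAC ler_wpM2r// ?(ltW (l0 i))//.
rewrite ler_pM2l//.
rewrite (_ : p' + _ - _ = (p' - p) + (q' - q) * z i); last by ring.
apply: (le_trans (ler_normD _ _)); rewrite lerD2l normrM (gtr0_norm zi0).
by rewrite ler_piMr.
Qed.

Lemma series_le_limit (R : realType) (u : R ^nat) (a : R) (N : nat) :
  (forall i, 0 <= u i) -> series u @ \oo --> a -> series u N <= a.
Proof.
move=> u0 ua; rewrite -(cvg_lim _ ua)//; apply: nondecreasing_cvgn_le.
  by apply: nondecreasing_series => i _ _; exact: u0.
exact: cvgP ua.
Qed.

Lemma inv2_dist (R : realType) (x y : R) : 1 <= x -> 1 <= y ->
  `|(2 * x)^-1 - (2 * y)^-1| <= `|x - y|.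
Proof.
move=> x1 y1; have xy0 : 0 < 2 * x * y by rewrite !mulr_gt0//; lra.
rewrite (_ : _ - (2 * y)^-1 = (y - x) / (2 * x * y)); last first.
  by field; rewrite !gt_eqF//; lra.
rewrite normrM distrC ler_piMr// normfV gtr0_norm// invf_le1//.
by nra.
Qed.

(** The value [g k] under the best allocation is continuous and exceeds [g 1] beyond some [M], so
    its minimum over [[1, M]] is global. *)
Lemma reduced_optimal_exists (R : realType) (lam : R ^nat) (rho : R)
    (f : R -> R) (t : R) :
  baseline_spectrum lam -> 0 < rho -> (forall k, 1 <= k -> 0 < f k) ->
  continuous_from1 f -> f x @[x --> +oo] --> +oo -> 0 < t ->
  exists k, reduced_optimal lam rho f t k.
Proof.
move=> hl rho0 f0 cf flim t0; have [l0 _ cl] := hl.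
have q0 (k : R) : 1 <= k -> 0 < (2 * k)^-1.
  by move=> k1; rewrite invr_gt0; lra.
(* For [k < 1] the constant allocation is a dummy value. *)
have /choice[Z hZ] : forall k, exists z : R ^nat, 1 <= k ->
    (exists n, waterfilling lam t (f k) (2 * k)^-1 n z) /\ allocation rho z.
  move=> k; have [k1|k1] := leP 1 k; last by exists (fun=> 1).
  have [n [z [wz az]]] := waterfilling_exists hl rho0 t0 (f0 k k1) (q0 k k1).
  by exists z => _; split => //; exists n.
pose g k := reduced_loss lam t (f k) (2 * k)^-1 (Z k).
have gmin k w : 1 <= k -> allocation rho w ->
    g k <= reduced_loss lam t (f k) (2 * k)^-1 w.
  move=> k1 aw; have [[n wz] az] := hZ k k1.
  exact: waterfilling_min hl t0 (f0 k k1) (q0 k k1) wz az aw.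
pose L := limn (series lam).
have L0 : 0 <= L.
  have := @series_le_limit _ lam L 0%N (fun i => ltW (l0 i)) cl.
  by rewrite /series/= big_geq.
have glip x k : 1 <= x -> 1 <= k ->
    g x <= g k + t * (`|f x - f k| + `|(2 * x)^-1 - (2 * k)^-1|) * L.
  move=> x1 k1; have [_ az] := hZ k k1.
  apply: (le_trans (gmin x (Z k) x1 az)).
  by apply: reduced_loss_lipschitz => //; [exact: f0|exact: q0|exact: f0|
    exact: q0|case: az].
have cg : continuous_from1 g.
  move=> k e k1 e0; pose c := e / (2 * (t * L + 1)).
  have tL0 : 0 < t * L + 1 by rewrite ltr_wpDl// mulr_ge0// ltW.
  have c0 : 0 < c by rewrite divr_gt0// mulr_gt0.
  have [d d0 hd] := cf k c k1 c0.
  exists (Num.min d c); first by rewrite lt_min d0.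
  move=> x x1; rewrite lt_min => /andP[xd xc].
  have hf := hd x x1 xd.
  have hq := le_lt_trans (inv2_dist x1 k1) xc.
  have h1 := glip x k x1 k1; have h2 := glip k x k1 x1.
  have h3 : t * (`|f x - f k| + `|(2 * x)^-1 - (2 * k)^-1|) * L < e.
    apply: (@le_lt_trans _ _ (t * L * (2 * c))).
      rewrite mulrAC ler_wpM2l ?mulr_ge0 ?(ltW t0)//; lra.
    rewrite (_ : t * L * (2 * c) = e * (t * L) / (t * L + 1)); last first.
      by rewrite /c; field; rewrite gt_eqF.
    by rewrite ltr_pdivrMr// ltr_pM2l// ltrDl.
  move: h2; rewrite (distrC (f k)) (distrC (2 * k)^-1) => h2.
  by rewrite ltr_norml; apply/andP; split; lra.
(* Direction 0 alone contributes at least [ln (1 + t * lam 0 * f k)], which exceeds [g 1] once [f k]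
   passes this threshold. *)
have [M [M1 hM]] : exists M, 1 <= M /\ forall k, M <= k -> g 1 < g k.
  move/cvgryPge: flim => /(_ ((expR (g 1) + 1) / (t * lam 0%N))).
  move=> [M [_ hM]]; exists (Num.max 1 (M + 1)); split.
    by rewrite le_max lexx.
  move=> k; rewrite ge_max => /andP[k1 Mk].
  have tl0 : 0 < t * lam 0%N by rewrite mulr_gt0.
  have := hM k; rewrite ler_pdivrMr// => hMk.
  have h := hMk ltac:(lra).
  have [_ [z01 _]] := hZ k k1.
  have zk i := z01 i.
  have ge0 i : 0 <= reduced_term lam t (f k) (2 * k)^-1 (Z k) i.
    by have /andP[] := reduced_term_bounds (l0 i) t0 (f0 k k1) (q0 k k1) (z01 i).
  have := series_le_limit 1 ge0 (cvg_reduced_loss hl t0 (f0 k k1) (q0 k k1) z01).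
  rewrite /series/= big_nat1.
  apply: lt_le_trans; rewrite -ltr_expR lnK; last first.
    rewrite posrE addr_gt0// mulr_gt0// addr_gt0 ?f0// mulr_gt0 ?q0//.
    by case/andP: (z01 0%N).
  have : 0 < t * lam 0%N * ((2 * k)^-1 * Z k 0%N).
    by rewrite mulr_gt0// mulr_gt0 ?q0//; case/andP: (z01 0%N).
  by lra.
have [k] := EVT_min M1 (continuous_from1_within (M := M) cg).
rewrite in_itv/= => /andP[k1 kM] hk; exists k; split => //.
have [[n wz] az] := hZ k k1; exists n, (Z k); split => // k' w k'1 aw.
apply: le_trans (gmin k' w k'1 aw); rewrite -/(g k).
have [k'M|/ltW Mk'] := leP k' M; first by apply: hk; rewrite in_itv/= k'1.
apply: le_trans (ltW (hM k' Mk')); apply: hk.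
by rewrite in_itv/= lexx.
Qed.

(* Attention lowers the reduced loss by at most [2 * rho], whereas the loss
   without attention, [\sum_i ln (1 + t * lam i * s)], separates distinct values
   of [s] by an unbounded amount as [t] grows, as there are infinitely many
   eigenvalues. *)
Lemma reduced_optimal_excess (R : realType) (lam : R ^nat) (rho : R)
    (f : R -> R) (c c' : R) :
  baseline_spectrum lam -> 0 < rho -> (forall k, 1 <= k -> 0 < f k) ->
  0 < c -> c < c' ->
  exists2 T, 0 < T & forall t k k', T <= t -> reduced_optimal lam rho f t k ->
    1 <= k' -> f k' + (2 * k')^-1 <= c -> f k + (2 * k)^-1 < c'.
Proof.
move=> hl rho0 f0 c0 cc'; have [l0 lni cl] := hl.
have q0 (k : R) : 1 <= k -> 0 < (2 * k)^-1.
  by move=> k1; rewrite invr_gt0; lra.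
(* [s] is the value of [(1 + x * c') / (1 + x * c)] at [x * c = 1], and a lower bound for it at
   larger [x]. *)
pose s := (c + c') / (2 * c).
have s1 : 1 < s by rewrite ltr_pdivlMr; lra.
have ls0 : 0 < ln s by rewrite ln_gt0.
pose N := Num.truncn (2 * rho / ln s).
have hN : 2 * rho < N.+1%:R * ln s.
  by rewrite -ltr_pdivrMr// truncnS_gt.
(* For [t] above this threshold, [t * lam i * c >= 1] for all [i <= N]; these [N.+1] directions
   together contribute more than [2 * rho]. *)
exists (lam N * c)^-1; first by rewrite invr_gt0 mulr_gt0.
move=> t k k' hT [k1 [n [z [wz az hz]]]] k'1 k'c; rewrite ltNge; apply/negP => kc'.
have T0 : 0 < (lam N * c)^-1 by rewrite invr_gt0 mulr_gt0.
have t0 : 0 < t := lt_le_trans T0 hT.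
have [z01 sz] := az.
have h1 := cvg_reduced_loss hl t0 (f0 k k1) (q0 k k1) z01.
have h2 := cvg_reduced_loss hl t0 (f0 k' k'1) (q0 k' k'1) z01.
have hle := hz k' z k'1 az.
(* Adding [- ln (z i)] more than undoes the effect of attention on the load of [k]. By optimality of
   [k] the total of [D] is at most [2 * rho], which the lower bounds below contradict. *)
pose D i := reduced_term lam t (f k) (2 * k)^-1 z i - ln (z i)
  - reduced_term lam t (f k') (2 * k')^-1 z i.
have hD : series D @ \oo --> reduced_loss lam t (f k) (2 * k)^-1 z + 2 * rho
    - reduced_loss lam t (f k') (2 * k')^-1 z.
  rewrite (_ : D = fun i => (reduced_term lam t (f k) (2 * k)^-1 z i + - ln (z i))
    + (-1) * reduced_term lam t (f k') (2 * k')^-1 z i); last first.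
    by apply/funext => i; rewrite mulN1r.
  rewrite -[X in _ - X]mul1r -mulNr.
  exact: cvg_seriesD (cvg_seriesD h1 sz) (cvg_seriesZ h2).
have Dlow i : ln ((1 + t * lam i * c') / (1 + t * lam i * c)) <= D i.
  have /andP[zi0 zi1] := z01 i.
  have tl0 : 0 < t * lam i by rewrite mulr_gt0.
  have c'0 : 0 < c' by exact: lt_trans cc'.
  have g x : 0 < x -> 0 < 1 + t * lam i * x by move=> x0; rewrite addr_gt0// mulr_gt0.
  have u0 : 0 < f k + (2 * k)^-1 * z i by rewrite addr_gt0 ?f0// mulr_gt0 ?q0.
  have u'0 : 0 < f k' + (2 * k')^-1 * z i by rewrite addr_gt0 ?f0// mulr_gt0 ?q0.
  rewrite ln_div ?posrE ?g// /D /reduced_term lerB//.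
    rewrite lerBrDr -lnM ?posrE ?g// ler_ln ?posrE ?mulr_gt0 ?g//.
    have a1 := ler_wpM2l (ltW tl0) kc'.
    have a2 := ler_wpM2r (ltW zi0) a1.
    have a3 : f k * z i <= f k by rewrite ger_pMr// f0.
    have a4 := ler_wpM2l (ltW tl0) a3.
    lra.
  rewrite ler_ln ?posrE ?g// lerD2l ler_pM2l//; apply: le_trans k'c.
  by rewrite lerD2l ger_pMr// q0.
have tc i : 0 < 1 + t * lam i * c by rewrite addr_gt0// !mulr_gt0.
have D0 i : 0 <= D i.
  apply: le_trans (Dlow i); rewrite ln_ge0// ler_pdivlMr// mul1r lerD2l.
  by rewrite ler_pM2l ?mulr_gt0// ltW.
have DN i : (i < N.+1)%N -> ln s <= D i.
  rewrite ltnS => iN; apply: le_trans (Dlow i).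
  rewrite ler_ln ?posrE; last 2 first.
  - by rewrite (lt_trans _ s1).
  - by rewrite divr_gt0// addr_gt0// mulr_gt0 ?mulr_gt0// (lt_trans c0).
  rewrite ler_pdivlMr// /s mulrAC ler_pdivrMr; last by rewrite mulr_gt0.
  have h : 1 <= t * lam i * c.
    move: hT; rewrite -[X in X <= _]mul1r ler_pdivrMr ?mulr_gt0// mulrA => h.
    apply: (le_trans h); rewrite ler_pM2r// ler_pM2l//; exact: lni.
  have := mulr_ge0 (_ : 0 <= c' - c) (_ : 0 <= t * lam i * c - 1).
  by rewrite !subr_ge0 => /(_ (ltW cc') h); lra.
have := series_le_limit N.+1 D0 hD.
have : N.+1%:R * ln s <= series D N.+1.
  rewrite /series/= big_mkord mulr_natl -[in leLHS](card_ord N.+1) -sumr_const.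
  by apply: ler_sum => i _; exact: DN.
by lra.
Qed.

(** Optimal sizes increase with [t], so they converge to their supremum [k0];
    [reduced_optimal_excess] shows both that [k0] is finite and that it minimizes [phi], which is
    twice the zero-attention criterion. *)
Lemma reduced_optimal_limit (R : realType) (lam : R ^nat) (rho : R)
    (f : R -> R) :
  baseline_spectrum lam -> 0 < rho -> (forall k, 1 <= k -> 0 < f k) ->
  (forall x y, 1 <= x -> x < y -> f x < f y) ->
  continuous_from1 f -> f x @[x --> +oo] --> +oo ->
  exists k0, zero_attention_team_size f k0 /\
    forall kopt : R -> R,
      (forall eta, 0 < eta -> reduced_optimal lam rho f eta^-1 (kopt eta)) ->
      kopt eta @[eta --> 0^'+] --> k0.
Proof.
move=> hl rho0 f0 fi cf flim.
have ex t : 0 < t -> exists k, reduced_optimal lam rho f t k.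
  by move=> t0; exact: reduced_optimal_exists.
have q0 (k : R) : 1 <= k -> 0 < (2 * k)^-1.
  by move=> k1; rewrite invr_gt0; lra.
pose phi k := f k + (2 * k)^-1.
have phi0 k : 1 <= k -> 0 < phi k by move=> k1; rewrite addr_gt0 ?f0 ?q0.
pose S := [set k | exists2 t, 0 < t & reduced_optimal lam rho f t k].
have S1 k : S k -> 1 <= k by case=> t _ [].
have mono t t' k k' : 0 < t -> t < t' -> reduced_optimal lam rho f t k ->
    reduced_optimal lam rho f t' k' -> k <= k'.
  move=> t0 tt' ok ok'.
  exact: (reduced_optimal_monotone hl rho0 f0 fi t0 tt' ok' ok).
(* For [t >= T] an optimal size has [phi] below [phi 1 + 1], which bounds [f k] and thus [k]; for
   smaller [t] monotonicity compares it with an optimal size at [T]. *)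
have hS : has_sup S.
  split; first by have [k ok] := ex 1 ltr01; exists k, 1.
  have c1 : phi 1 < phi 1 + 1 by rewrite ltrDl.
  have [T T0 hT] := reduced_optimal_excess hl rho0 f0 (phi0 1 (lexx 1)) c1.
  move/cvgryPge: flim => /(_ (phi 1 + 1))[M [_ hM]].
  have B t k : T <= t -> reduced_optimal lam rho f t k -> k <= M.
    move=> Tt ok; rewrite leNgt; apply/negP => /hM h.
    have := hT t k 1 Tt ok (lexx 1) (lexx _).
    have [k1 _] := ok; have := q0 k k1; lra.
  exists M => k [t t0 ok].
  have [Tt|tT] := leP T t; first exact: B ok.
  have [k' ok'] := ex T T0.
  by apply: le_trans (B T k' (lexx T) ok'); exact: mono tT ok ok'.
pose k0 := sup S.
have leS k : S k -> k <= k0 by move=> Sk; apply: ub_le_sup => //; case: hS.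
have k01 : 1 <= k0 by have [[k Sk] _] := hS; exact: le_trans (S1 k Sk) (leS k Sk).
have near_k0 d : 0 < d ->
    exists t k, [/\ 0 < t, reduced_optimal lam rho f t k & k0 - d < k].
  by move=> /(sup_adherent)/(_ hS)[k [t t0 ok] kd]; exists t, k.
exists k0; split.
  split=> // k k1; suff : phi k0 <= phi k.
    have E x : 1 <= x -> (4 * x)^-1 + f x / 2 = phi x / 2.
      by move=> x1; rewrite /phi; field; rewrite gt_eqF//; lra.
    by rewrite !E//; lra.
  rewrite leNgt; apply/negP => phik.
  (* Then [phi k + e = phi k0 - e]: for large [t] optimal sizes have [phi] below this value, while
     continuity at [k0] keeps it above. *)
  pose e := (phi k0 - phi k) / 2.
  have e0 : 0 < e by rewrite divr_gt0// subr_gt0.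
  have [T T0 hT] : exists2 T, 0 < T & forall t k1 k', T <= t ->
      reduced_optimal lam rho f t k1 -> 1 <= k' -> f k' + (2 * k')^-1 <= phi k ->
      f k1 + (2 * k1)^-1 < phi k + e.
    by apply: reduced_optimal_excess => //; rewrite ?phi0// ltrDl.
  have e20 : 0 < e / 2 by rewrite divr_gt0.
  have [d d0 hd] := cf k0 (e / 2) k01 e20.
  have dd0 : 0 < Num.min d (e / 2) by rewrite lt_min d0.
  have [t [x [t0 ox kx]]] := near_k0 _ dd0.
  (* Exceeding [T] gives the excess bound for [y]; exceeding [t] places [y] between [x] and [k0]. *)
  pose t' := Num.max T t + 1.
  have t'0 : 0 < t' by rewrite ltr_wpDl// le_max (ltW T0).
  have [y oy] := ex t' t'0.
  have [y1 _] := oy.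
  have xy : x <= y.
    apply: mono ox oy => //; rewrite /t' (@le_lt_trans _ _ (Num.max T t)) ?ltrDl//.
    by rewrite le_max lexx orbT.
  have yk0 : y <= k0 by apply: leS; exists t'.
  have hy : phi y < phi k + e.
    apply: (hT t' y k) => //; rewrite /t' (@le_trans _ _ (Num.max T t)) ?lerDl//.
    by rewrite le_max lexx.
  have yd : `|y - k0| < Num.min d (e / 2).
    by rewrite distrC ger0_norm ?subr_ge0//; lra.
  move: (yd); rewrite lt_min => /andP[yd1 yd2].
  have := hd y y1 yd1; have := le_lt_trans (inv2_dist y1 k01) yd2.
  rewrite !ltr_norml => /andP[h1 h1'] /andP[h2 h2'].
  by move: hy; rewrite /e /phi in h1 h1' h2 h2' *; lra.
move=> kopt hk; apply/cvgrPdist_lt => e e0.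
have [t [x [t0 ox kx]]] := near_k0 e e0.
near=> eta.
have eta0 : 0 < eta by near: eta; exact: nbhs_right_gt.
have etat : eta < t^-1.
  by near: eta; apply: nbhs_right_lt; rewrite invr_gt0.
have te : t < eta^-1 by rewrite -[t]invrK ltf_pV2 ?posrE// invr_gt0.
have h1 := mono _ _ _ _ t0 te ox (hk eta eta0).
have h2 : kopt eta <= k0.
  by apply: leS; exists eta^-1; [rewrite invr_gt0|exact: hk].
by rewrite ger0_norm ?subr_ge0//; lra.
Unshelve. all: by end_near. Qed.

(** * The total loss in terms of the reduced loss *)

Lemma num_attendedE (R : realType) (lamt : R ^nat) (mu : R) (N : nat) :
  (forall i, (N <= i)%N -> lamt i <= mu) ->
  num_attended lamt mu = count (fun i => mu < lamt i) (iota 0 N).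
Proof.
move=> hN; rewrite /num_attended -size_filter.
have fA : finite_set [set i | mu < lamt i].
  apply: (sub_finite_set _ (finite_II N)) => i /= h.
  by rewrite ltnNge; apply/negP => /hN; rewrite leNgt h.
apply: perm_size; apply: uniq_perm.
- exact: fset_uniq.
- by rewrite filter_uniq ?iota_uniq.
- move=> i; rewrite (in_fset_set fA) mem_filter mem_iota add0n leq0n /=.
  apply/idP/idP => [/set_mem /= h|/andP[h _]]; last exact/mem_set.
  rewrite h /= ltnNge; apply/negP => /hN.
  by rewrite leNgt h.
Qed.

(** An attended direction keeps variance [mu], any other keeps [lamt i <= mu]. Summability makes the
    attended set finite, so [num_attended] is a genuine count. *)
Lemma residual_varianceE (R : realType) (lamt : R ^nat) (mu : R) :
  (forall i, 0 <= lamt i) -> 0 < mu -> cvgn (series lamt) ->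
  residual_variance lamt mu =
  (\sum_(0 <= i <oo) (Num.min (lamt i) mu)%:E)%E.
Proof.
move=> x0 mu0 cx; have [N _ hN] : \forall i \near \oo, lamt i <= mu.
  have /cvgr0Pnorm_lt := cvg_series_cvg_0 cx.
  by move=> /(_ mu mu0); apply: filterS => i /ltW; rewrite ger0_norm.
rewrite /residual_variance (num_attendedE (N := N)); last exact: hN.
rewrite eseries_mkcond.
have s2 : series (fun i => if mu < lamt i then mu else 0) @ \oo -->
    (count (fun i => mu < lamt i) (iota 0 N))%:R * mu.
  apply: cvg_near_cst; near=> m; rewrite /series/=.
  have Nm : (N <= m)%N by near: m; exact: nbhs_infty_ge.
  rewrite (big_cat_nat (n := N))//= -[RHS]addr0; congr (_ + _); last first.
    by rewrite big_nat; apply: big1 => i /andP[Ni _]; rewrite ltNge hN.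
  by rewrite -big_mkcond/= big_const_seq iter_addr addr0 mulr_natl /index_iota subn0.
rewrite -(series_nneseries s2) -nneseriesD => [|i _ _|i _ _]; last 2 first.
- by case: ifP => _; rewrite lee_fin// ltW.
- by case: ifP => _; rewrite ?lee_fin.
apply: eq_eseriesr => i _; rewrite minElt; have [h|h] := ltP mu (lamt i).
  by rewrite adde0 ltNge (ltW h).
rewrite add0e; case: ltP => // h'.
by congr (_%:E); apply/le_anti; rewrite h h'.
Unshelve. all: by end_near. Qed.

Definition loss_term (R : realType) (lam : R ^nat) (eta k p mu : R)
    (lamt : R ^nat) : R ^nat :=
  fun i => (4 * k)^-1 * Num.min (lamt i) mu + p / 2 * lamt i
    + eta * (2^-1 * (lamt i / lam i - 1 - ln (lamt i / lam i))).

Lemma kl_term_ge0 (R : realType) (s : R) : 0 < s -> 0 <= s - 1 - ln s.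
Proof. by move=> s0; rewrite subr_ge0 ln_le_sub1. Qed.

Lemma total_lossE (R : realType) (f : R -> R) (lam lamt : R ^nat)
    (eta k mu : R) :
  (forall i, 0 < lam i) -> (forall i, 0 < lamt i) -> 0 < mu ->
  cvgn (series lamt) -> 0 < eta -> 1 <= k -> 0 < f k ->
  total_loss f lam eta k lamt mu =
  (\sum_(0 <= i <oo) (loss_term lam eta k (f k) mu lamt i)%:E)%E.
Proof.
move=> l0 x0 mu0 cx eta0 k1 f0.
have k40 : 0 <= (4 * k)^-1 by rewrite invr_ge0; lra.
have f20 : 0 <= f k / 2 by lra.
have r0 i : 0 <= 2^-1 * (lamt i / lam i - 1 - ln (lamt i / lam i)).
  by rewrite mulr_ge0 ?invr_ge0// kl_term_ge0// divr_gt0.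
have m0 i : 0 <= Num.min (lamt i) mu by rewrite le_min !ltW.
rewrite /total_loss residual_varianceE//; last by move=> i; exact: ltW.
have -> : kl_div lamt lam = (\sum_(0 <= i <oo)
    (2^-1 * (lamt i / lam i - 1 - ln (lamt i / lam i)))%:E)%E.
  rewrite /kl_div -nneseriesZl => [|i _]; last first.
    by rewrite x0 lee_fin kl_term_ge0// divr_gt0.
  by apply: eq_eseriesr => i _; rewrite x0 EFinM.
rewrite -!nneseriesZl; [|by move=> i _; rewrite lee_fin ?(ltW (x0 i))..].
rewrite -!nneseriesD; first by apply: eq_eseriesr.
- by move=> i _ _; rewrite -!EFinM -EFinD lee_fin addr_ge0// mulr_ge0// ltW.
- by move=> i _ _; rewrite -EFinM lee_fin mulr_ge0// ltW.
- by move=> i _ _; rewrite -EFinM lee_fin mulr_ge0// ltW.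
- by move=> i _ _; rewrite -EFinM lee_fin mulr_ge0// ltW.
Qed.

(** A zero eigenvalue makes the divergence infinite, a divergent total variance makes the second
    term infinite, and no term is negative. *)
Lemma total_loss_pinfty (R : realType) (f : R -> R) (lam lamt : R ^nat)
    (eta k mu : R) :
  (forall i, 0 < lam i) -> (forall i, 0 <= lamt i) -> 0 < mu ->
  0 < eta -> 1 <= k -> 0 < f k ->
  ~ ((forall i, 0 < lamt i) /\ cvgn (series lamt)) ->
  (total_loss f lam eta k lamt mu = +oo)%E.
Proof.
move=> l0 x0 mu0 eta0 k1 f0 hn.
have kl0 i : (0 <= if (0 < lamt i)%R
    then (lamt i / lam i - 1 - ln (lamt i / lam i))%:E else +oo)%E.
  by case: ifP => // xi; rewrite lee_fin kl_term_ge0// divr_gt0.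
have A0 : (0 <= ((4 * k)^-1)%:E * residual_variance lamt mu)%E.
  rewrite mule_ge0 ?lee_fin ?invr_ge0//; first by lra.
  rewrite adde_ge0 ?lee_fin ?mulr_ge0 ?(ltW mu0)//.
  by apply: nneseries_ge0 => i _ _; rewrite lee_fin.
have S0 : (0 <= \sum_(0 <= i <oo) (lamt i)%:E)%E.
  by apply: nneseries_ge0 => i _ _; rewrite lee_fin.
have B0 : (0 <= (f k / 2)%:E * (\sum_(0 <= i <oo) (lamt i)%:E))%E.
  by rewrite mule_ge0// lee_fin; lra.
have C0 : (0 <= eta%:E * kl_div lamt lam)%E.
  rewrite mule_ge0 ?lee_fin ?(ltW eta0)// /kl_div mule_ge0 ?lee_fin ?invr_ge0//.
  by apply: nneseries_ge0 => i _ _; exact: kl0.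
have nNy (x : \bar R) : (0 <= x)%E -> (x != -oo)%E by case: x.
have [xpos|/existsNP[j /negP]] := pselect (forall i, 0 < lamt i).
  have e : (\sum_(0 <= i <oo) (lamt i)%:E = +oo)%E.
    apply/eqP; rewrite eq_le leey leNgt; apply/negP => h; apply: hn; split => //.
    exact: nnseries_is_cvg.
  rewrite /total_loss e gt0_muley ?lte_fin; last by lra.
  by rewrite addey ?nNy// addye ?nNy.
move=> xj; rewrite /total_loss /kl_div.
have -> : (\sum_(0 <= i <oo) (if (0 < lamt i)%R
    then (lamt i / lam i - 1 - ln (lamt i / lam i))%:E else +oo) = +oo)%E.
  by apply: (@eseries_pinfty _ _ _ j) => //= [i _|]; [exact: nNy|rewrite (negbTE xj)].
rewrite !gt0_muley ?lte_fin ?invr_gt0// addey// nNy//.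
by rewrite adde_ge0.
Qed.

(** With [r = lamt i / lam i] and [a = 1 + eta^-1 * lam i * (p + (2 * k)^-1 * z)], the term is
    [eta / 2 * (a * r - 1 - ln r)]. Writing [s = a * r] isolates the nonnegative part
    [s - 1 - ln s], which vanishes at [lamt i = lam i / a]. *)
Lemma loss_term_decomposition (R : realType) (lam lamt : R ^nat)
    (eta k p mu z s : R) (i : nat) :
  0 < lam i -> 0 < lamt i -> 0 < eta -> 1 <= k -> 0 < p -> 0 < z ->
  Num.min (lamt i) mu = lamt i * z ->
  s = lamt i / lam i * (1 + eta^-1 * lam i * (p + (2 * k)^-1 * z)) ->
  loss_term lam eta k p mu lamt i =
  eta / 2 * (ln (1 + eta^-1 * lam i * (p + (2 * k)^-1 * z)) + (s - 1 - ln s)).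
Proof.
move=> l0 x0 eta0 k1 p0 z0 hz ->; have k0 : 0 < k by lra.
have a0 : 0 < 1 + eta^-1 * lam i * (p + (2 * k)^-1 * z).
  rewrite addr_gt0// mulr_gt0 ?mulr_gt0 ?invr_gt0// addr_gt0// mulr_gt0//.
  by rewrite invr_gt0 mulr_gt0.
have r0 : 0 < lamt i / lam i by rewrite divr_gt0.
rewrite /loss_term hz [ln (_ * (1 + _))]lnM ?posrE//.
set A := ln (1 + _); set B := ln (_ / _).
by field; rewrite !gt_eqF.
Qed.

Lemma water_level_sum (R : realType) (rho : R) (u : R ^nat) :
  (forall i, 0 <= u i) ->
  ((2^-1)%:E * \sum_(0 <= i <oo) (u i)%:E = rho%:E)%E <->
  series u @ \oo --> 2 * rho.
Proof.
move=> u0; split => [|h]; last first.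
  by rewrite (series_nneseries h) -EFinM mulrA mulVf// mul1r.
move=> h; apply: nneseries_series => //.
have : (0 <= \sum_(0 <= i <oo) (u i)%:E)%E.
  by apply: nneseries_ge0 => i _ _; rewrite lee_fin.
move: h; case: (\sum_(0 <= i <oo) (u i)%:E)%E => [x|//|//] .
  by rewrite -EFinM => -[<-] _; rewrite mulrA mulfV// mul1r.
by rewrite gt0_muley// lte_fin invr_gt0.
Qed.

Lemma attention_max_ln (R : realType) (x mu : R) : 0 < x -> 0 < mu ->
  Num.max 0 (ln (x / mu)) = - ln (Num.min 1 (mu / x)).
Proof.
move=> x0 mu0; have e : ln (x / mu) = - ln (mu / x).
  by rewrite -lnV ?posrE ?divr_gt0// invf_div.
rewrite e minEle; case: ifPn => [h|].
  by rewrite ln1 oppr0; apply/max_idPl; rewrite oppr_le0 ln_ge0.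
rewrite -ltNge => /ltW h; apply/max_idPr.
by rewrite oppr_ge0 ln_le0.
Qed.

(** The posterior reductions [z i = min 1 (mu / lamt i)] form an allocation, and dropping
    [s - 1 - ln s] from each term of the loss leaves the reduced loss. *)
Lemma total_loss_ge (R : realType) (f : R -> R) (lam lamt : R ^nat)
    (rho eta k mu : R) :
  baseline_spectrum lam -> (forall i, 0 <= lamt i) ->
  water_level rho lamt mu -> 0 < eta -> 1 <= k -> 0 < f k ->
  (total_loss f lam eta k lamt mu = +oo)%E \/
  exists z, allocation rho z /\
    ((eta / 2 * reduced_loss lam eta^-1 (f k) (2 * k)^-1 z)%:E <=
      total_loss f lam eta k lamt mu)%E.
Proof.
move=> hl x0 [mu0 hw] eta0 k1 f0; have [l0 _ _] := hl.
have [[xpos cx]|hn] := pselect ((forall i, 0 < lamt i) /\ cvgn (series lamt));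
  last by left; exact: total_loss_pinfty.
right; pose z i := Num.min 1 (mu / lamt i).
have z01 i : 0 < z i <= 1 by rewrite ge_min lexx lt_min ltr01 divr_gt0.
have hz i : Num.min (lamt i) mu = lamt i * z i.
  by rewrite /z minr_pMr ?(ltW (xpos i))// mulr1 mulrCA mulfV ?mulr1 ?gt_eqF.
have k0 : 0 < (2 * k)^-1 by rewrite invr_gt0; lra.
have t0 : 0 < eta^-1 by rewrite invr_gt0.
exists z; split.
  split=> //; apply/water_level_sum => [i|].
    by have /andP[_ zi] := z01 i; rewrite oppr_ge0 ln_le0.
  rewrite -hw; congr (_ * _)%E; apply: eq_eseriesr => i _.
  by rewrite attention_max_ln.
rewrite total_lossE//.
rewrite -(series_nneseries (cvg_seriesZ (cvg_reduced_loss hl t0 f0 k0 z01))).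
have rt i := reduced_term_bounds (l0 i) t0 f0 k0 (z01 i).
apply: lee_nneseries => i _.
  by rewrite lee_fin mulr_ge0 ?divr_ge0 ?(ltW eta0)//; case/andP: (rt i).
have /andP[zi0 _] := z01 i.
rewrite lee_fin (loss_term_decomposition (l0 i) (xpos i) eta0 k1 f0 zi0 (hz i) erefl).
rewrite ler_pM2l ?divr_gt0// lerDl kl_term_ge0//.
rewrite mulr_gt0 ?divr_gt0// addr_gt0// mulr_gt0 ?mulr_gt0 ?invr_gt0//.
by rewrite addr_gt0// mulr_gt0.
Qed.

(** The bound of [total_loss_ge] is attained when [s = 1] in every direction. In an attended
    direction the denominator of [lamt i] is then [(1 + t * lam i * p) * (1 + t * n)], so
    [lamt i * z i] equals the constant [n / q / (1 + t * n)], the water level [mu] of the new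
    spectrum. *)
Lemma total_loss_waterfilling (R : realType) (f : R -> R) (lam z : R ^nat)
    (rho eta k n : R) :
  baseline_spectrum lam -> 0 < eta -> 1 <= k -> 0 < f k ->
  waterfilling lam eta^-1 (f k) (2 * k)^-1 n z -> allocation rho z ->
  exists (lamt : R ^nat) (mu : R),
    [/\ forall i, 0 < lamt i <= lam i, water_level rho lamt mu
      & total_loss f lam eta k lamt mu =
        (eta / 2 * reduced_loss lam eta^-1 (f k) (2 * k)^-1 z)%:E].
Proof.
move=> hl eta0 k1 f0 [n0 zE] [z01 sz]; have [l0 _ cl] := hl.
have k0 : 0 < (2 * k)^-1 by rewrite invr_gt0; lra.
have t0 : 0 < eta^-1 by rewrite invr_gt0.
set t := eta^-1 in t0 zE *; set q := (2 * k)^-1 in k0 zE *; set p := f k in f0 zE *.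
pose a i := 1 + t * lam i * (p + q * z i).
have a1 i : 1 <= a i.
  have /andP[zi0 _] := z01 i.
  by rewrite lerDl !mulr_ge0 ?addr_ge0 ?mulr_ge0// ltW.
have a0 i : 0 < a i by exact: lt_le_trans (a1 i).
(* The minimizer of [loss_term] given [z], by [loss_term_decomposition]. *)
pose lamt i := lam i / a i; pose mu := n / q / (1 + t * n).
have x0 i : 0 < lamt i by rewrite divr_gt0.
have xl i : lamt i <= lam i by rewrite ler_pdivrMr// ler_peMr// ltW.
have tn0 : 0 < 1 + t * n by rewrite addr_gt0// mulr_gt0.
have mu0 : 0 < mu by rewrite !divr_gt0.
(* The same [z] is water-filling for [lamt]: with [d] the marginal, [mu / lamt i] is [n / d] times a
   factor that is 1 in attended directions and keeps the ratio at least 1 in the others. *)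
have zmu i : z i = Num.min 1 (mu / lamt i).
  have li0 := l0 i; have d0 := marginal_gt0 li0 t0 f0 k0.
  have c0 : 0 < 1 + t * lam i * p by rewrite addr_gt0// !mulr_gt0.
  have e : mu / lamt i = n / marginal lam t p q i *
      ((1 + t * marginal lam t p q i * z i) / (1 + t * n)).
    rewrite /mu /lamt /a /marginal; field.
    rewrite !gt_eqF//=.
    exact: a0.
  move: (zE i); rewrite e; set d := marginal _ _ _ _ _ in d0 *.
  rewrite !minEle; case: ifPn => [h ->|]; last first.
    rewrite -ltNge => h ->; have -> : t * d * (n / d) = t * n.
      by field; rewrite gt_eqF.
    by rewrite divff ?gt_eqF// mulr1 leNgt h.
  rewrite mulr1; have dn : d <= n by move: h; rewrite ler_pdivlMr// mul1r.
  suff -> : 1 <= n / d * ((1 + t * d) / (1 + t * n)) by [].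
  have tdn0 : 0 < d + t * d * n := addr_gt0 d0 (mulr_gt0 (mulr_gt0 t0 d0) n0).
  have -> : n / d * ((1 + t * d) / (1 + t * n)) = (n + t * d * n) / (d + t * d * n).
    by field; rewrite !gt_eqF.
  by rewrite ler_pdivlMr// mul1r lerD2r.
have hz i : Num.min (lamt i) mu = lamt i * z i.
  by rewrite zmu minr_pMr ?(ltW (x0 i))// mulr1 mulrCA mulfV ?mulr1 ?gt_eqF.
have cx : cvgn (series lamt).
  apply: (@series_le_cvg _ lamt lam) => // i; exact: ltW.
exists lamt, mu; split => [i||]; first by rewrite x0 xl.
  split=> //; rewrite (eq_eseriesr (g := fun i => (- ln (z i))%:E)) => [|i _].
    apply/water_level_sum => // i.
    by have /andP[_ zi] := z01 i; rewrite oppr_ge0 ln_le0.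
  by rewrite attention_max_ln// -zmu.
rewrite total_lossE//.
rewrite -(series_nneseries (cvg_seriesZ (cvg_reduced_loss hl t0 f0 k0 z01))).
apply: eq_eseriesr => i _; have /andP[zi0 _] := z01 i.
rewrite (@loss_term_decomposition _ _ _ _ _ _ _ (z i) 1)//.
  by rewrite ln1 subrr subr0 addr0.
by rewrite -/(a i) /lamt; field; rewrite !gt_eqF.
Qed.

(** * Kernels with smaller eigenvalues *)

Lemma continuous_unit_integrable (R : realType) (g : R -> R) :
  {within `[0, 1], continuous g} ->
  lebesgue_measure.-integrable `[0, 1]%classic (fun t : R => (g t)%:E).
Proof.
by move=> cg; apply: continuous_compact_integrable cg; exact: segment_compact.
Qed.

Lemma within_continuousM (R : realType) (A : set R) (g h : R -> R) :
  {within A, continuous g} -> {within A, continuous h} ->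
  {within A, continuous (fun t => g t * h t)}.
Proof. by move=> cg ch t; apply: cvgM; [exact: cg|exact: ch]. Qed.

Lemma within_continuous_sum (R : realType) (A : set R) (N : nat)
    (u : nat -> R -> R) :
  (forall i, {within A, continuous (u i)}) ->
  {within A, continuous (fun t => \sum_(0 <= i < N) u i t)}.
Proof.
move=> cu; elim: N => [|N IH].
  rewrite (_ : (fun _ => _) = cst 0); first by move=> t; exact: cvg_cst.
  by apply/funext => t; rewrite big_geq.
rewrite (_ : (fun _ => _) = (fun t => \sum_(0 <= i < N) u i t + u N t)).
  by move=> t; apply: cvgD; [exact: IH|exact: cu].
by apply/funext => t; rewrite big_nat_recr.
Qed.

Lemma Rintegral_sum_unit (R : realType) (N : nat) (u : nat -> R -> R) :
  (forall i, {within `[0, 1], continuous (u i)}) ->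
  \int[lebesgue_measure]_(t in `[0, 1]%classic) (\sum_(0 <= i < N) u i t) =
  \sum_(0 <= i < N) \int[lebesgue_measure]_(t in `[0, 1]%classic) u i t.
Proof.
move=> cu; elim: N => [|N IH].
  rewrite big_geq//; under eq_Rintegral do rewrite big_geq//.
  by rewrite Rintegral_cst// mul0r.
rewrite big_nat_recr//= -IH -RintegralD//.
- by apply: eq_Rintegral => t _; rewrite big_nat_recr.
- by apply: continuous_unit_integrable; exact: within_continuous_sum.
- exact: continuous_unit_integrable.
Qed.

Lemma cvg_fst_within (T U : topologicalType) (A : set T) (B : set U)
    (x : T) (y : U) :
  fst @ within (A `*` B) (nbhs (x, y)) --> within A (nbhs x).
Proof.
move=> P hP; exists ([set s | A s -> P s], setT); first by split => //; exact: filterT.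
by move=> [s t] [/= h _] [As _]; exact: h.
Qed.

Lemma cvg_snd_within (T U : topologicalType) (A : set T) (B : set U)
    (x : T) (y : U) :
  snd @ within (A `*` B) (nbhs (x, y)) --> within B (nbhs y).
Proof.
move=> P hP; exists (setT, [set s | B s -> P s]); first by split => //; exact: filterT.
by move=> [s t] [/= _ h] [_ Bt]; exact: h.
Qed.

Lemma covariance_diagonal_continuous (R : realType) (K : R -> R -> R) :
  covariance_kernel K -> {within `[0, 1], continuous (fun t => K t t)}.
Proof.
move=> hK; have := cov_continuous hK.
move=> /subspace_continuousP cK; apply/subspace_continuousP => t t01.
apply: (cvg_comp (fun t : R => (t, t)) _ _ (cK (t, t) (conj t01 t01))).
move=> P; rewrite /within/= => -[[U V] [/= Ut Vt] h].
apply: filterS2 Ut Vt => s Us Vs s01; exact: (h (s, s)).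
Qed.

(** By orthonormality the partial sums of [lam] are integrals of partial expansions of [K t t],
    hence at most the integrated variance. *)
Lemma kl_summable (R : realType) (K : R -> R -> R) (lam : R ^nat)
    (e : nat -> R -> R) :
  covariance_kernel K -> karhunen_loeve K lam e -> cvgn (series lam).
Proof.
move=> hK hKL; have lam0 := kl_eigenvalue_ge0 hKL.
have cv i : {within `[0, 1], continuous (fun t => lam i * (e i t * e i t))}.
  apply: within_continuousM; first by move=> t; exact: cvg_cst.
  by apply: within_continuousM; exact: kl_continuous hKL i.
have cd := covariance_diagonal_continuous hK.
apply: nondecreasing_is_cvgn; first exact: nondecreasing_series.
exists (\int[lebesgue_measure]_(t in `[0, 1]%classic) (K t t)) => _ [N _ <-].
have -> : series lam N = \int[lebesgue_measure]_(t in `[0, 1]%classic)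
    (\sum_(0 <= i < N) lam i * (e i t * e i t)).
  rewrite Rintegral_sum_unit//; apply: eq_bigr => i _.
  rewrite RintegralZl//; last first.
    apply: continuous_unit_integrable.
    by apply: within_continuousM; exact: kl_continuous hKL i.
  by rewrite (kl_orthonormal hKL) eqxx mulr1.
apply: le_Rintegral => //.
- by apply: continuous_unit_integrable; exact: within_continuous_sum.
- exact: continuous_unit_integrable.
move=> t t01; have := kl_expansion hKL t01 t01.
rewrite (_ : (fun j => _) = (fun j => lam j * (e j t * e j t))); last first.
  by apply/funext => j; rewrite mulrA.
apply: series_le_limit => j; rewrite mulr_ge0//.
by rewrite -expr2 sqr_ge0.
Qed.

(** Mercer series with new eigenvalues on the old eigenfunctions; [limn] is a true limit on the unit
    square when [0 <= x j <= lam j]. *)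
Definition reweighted_kernel (R : realType) (x : R ^nat) (e : nat -> R -> R)
    (s t : R) : R :=
  limn (series (fun j => x j * e j s * e j t)).

Definition mercer_tail (R : realType) (K : R -> R -> R) (lam : R ^nat)
    (e : nat -> R -> R) (N : nat) (t : R) : R :=
  K t t - \sum_(0 <= j < N) lam j * e j t * e j t.

(** From [2 * |a * b| <= a ^ 2 + b ^ 2]: off-diagonal terms are dominated by diagonal terms of the
    expansion of [K]. *)
Lemma reweighted_term_le (R : realType) (lam x : R ^nat) (e : nat -> R -> R)
    (j : nat) (s t : R) :
  0 <= x j <= lam j ->
  `|x j * e j s * e j t| <=
  2^-1 * (lam j * e j s * e j s + lam j * e j t * e j t).
Proof.
move=> /andP[x0 xl]; rewrite -mulrA normrM ger0_norm//.
have h : `|e j s * e j t| <= 2^-1 * (e j s * e j s + e j t * e j t).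
  rewrite ler_norml; apply/andP; split.
    have := sqr_ge0 (e j s + e j t); nra.
  have := sqr_ge0 (e j s - e j t); nra.
apply: (le_trans (ler_pM x0 (normr_ge0 _) xl h)).
by rewrite le_eqVlt; apply/orP; left; apply/eqP; field.
Qed.

Lemma kl_diagonal (R : realType) (K : R -> R -> R) (lam : R ^nat)
    (e : nat -> R -> R) (t : R) :
  karhunen_loeve K lam e -> `[0, 1]%classic t ->
  series (fun j => lam j * e j t * e j t) @ \oo --> K t t.
Proof. by move=> hKL t01; exact: kl_expansion. Qed.

Lemma kl_diagonal_term_ge0 (R : realType) (K : R -> R -> R) (lam : R ^nat)
    (e : nat -> R -> R) (j : nat) (t : R) :
  karhunen_loeve K lam e -> 0 <= lam j * e j t * e j t.
Proof.
by move=> hKL; rewrite -mulrA mulr_ge0 ?(kl_eigenvalue_ge0 hKL)// -expr2 sqr_ge0.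
Qed.

Lemma reweighted_kernel_cvg (R : realType) (K : R -> R -> R) (lam x : R ^nat)
    (e : nat -> R -> R) (s t : R) :
  karhunen_loeve K lam e -> (forall j, 0 <= x j <= lam j) ->
  `[0, 1]%classic s -> `[0, 1]%classic t ->
  series (fun j => x j * e j s * e j t) @ \oo --> reweighted_kernel x e s t.
Proof.
move=> hKL hx s01 t01.
suff : cvgn (series (fun j => x j * e j s * e j t)) by [].
apply: normed_cvg => /=.
have hv := cvg_seriesZ (c := 2^-1)
  (cvg_seriesD (kl_diagonal hKL s01) (kl_diagonal hKL t01)).
have [|a ha] := ge0_series_cvg_le (u := fun j => `|x j * e j s * e j t|) _ hv.
  by move=> j; rewrite normr_ge0 reweighted_term_le.
exact: cvgP ha.
Qed.

(** Termwise domination by the diagonal gives a truncation error controlled by the Mercer tails of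
    [K], whatever the weights [x]. *)
Lemma reweighted_kernel_tail (R : realType) (K : R -> R -> R) (lam x : R ^nat)
    (e : nat -> R -> R) (N : nat) (s t : R) :
  karhunen_loeve K lam e -> (forall j, 0 <= x j <= lam j) ->
  `[0, 1]%classic s -> `[0, 1]%classic t ->
  `|reweighted_kernel x e s t - \sum_(0 <= j < N) x j * e j s * e j t| <=
  2^-1 * (mercer_tail K lam e N s + mercer_tail K lam e N t).
Proof.
move=> hKL hx s01 t01.
pose S m := \sum_(0 <= j < m) x j * e j s * e j t.
pose V r m := \sum_(0 <= j < m) lam j * e j r * e j r.
have h1 : (fun m => `|S m - S N|) @ \oo --> `|reweighted_kernel x e s t - S N|.
  apply: cvg_norm; apply: cvgB; last exact: cvg_cst.
  exact: reweighted_kernel_cvg hKL hx s01 t01.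
have hV r : `[0, 1]%classic r -> (fun m => V r m - V r N) @ \oo --> K r r - V r N.
  by move=> r01; apply: cvgB; [exact: kl_diagonal hKL r01|exact: cvg_cst].
have h2 : (fun m => 2^-1 * ((V s m - V s N) + (V t m - V t N))) @ \oo -->
    2^-1 * ((K s s - V s N) + (K t t - V t N)).
  by apply: cvgMl_tmp; apply: cvgD; exact: hV.
apply: (ler_cvg_to h1 h2); near=> m.
have Nm : (N <= m)%N by near: m; exact: nbhs_infty_ge.
have split_sum (u : R ^nat) : \sum_(0 <= j < m) u j - \sum_(0 <= j < N) u j =
    \sum_(N <= j < m) u j.
  by rewrite (big_cat_nat (n := N))//= addrAC subrr add0r.
rewrite /S /V !split_sum -big_split/= mulr_sumr.
apply: (le_trans (ler_norm_sum _ _ _)).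
by apply: ler_sum => j _; exact: reweighted_term_le.
Unshelve. all: by end_near. Qed.

Lemma reweighted_partial_le (R : realType) (K : R -> R -> R) (lam x : R ^nat)
    (e : nat -> R -> R) (N : nat) (s t : R) :
  karhunen_loeve K lam e -> (forall j, 0 <= x j <= lam j) ->
  `[0, 1]%classic s -> `[0, 1]%classic t ->
  `|\sum_(0 <= j < N) x j * e j s * e j t| <= 2^-1 * (K s s + K t t).
Proof.
move=> hKL hx s01 t01; apply: (le_trans (ler_norm_sum _ _ _)).
have hv := cvg_seriesZ (c := 2^-1)
  (cvg_seriesD (kl_diagonal hKL s01) (kl_diagonal hKL t01)).
apply: le_trans (series_le_limit N _ hv).
  by apply: ler_sum => j _; exact: reweighted_term_le.
move=> j; rewrite mulr_ge0// ?invr_ge0// addr_ge0//;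
  exact: kl_diagonal_term_ge0 hKL.
Qed.

Lemma mercer_tail_continuous (R : realType) (K : R -> R -> R) (lam : R ^nat)
    (e : nat -> R -> R) (N : nat) :
  covariance_kernel K -> karhunen_loeve K lam e ->
  {within `[0, 1], continuous (mercer_tail K lam e N)}.
Proof.
move=> hK hKL; apply: within_continuousB.
  exact: covariance_diagonal_continuous.
apply: within_continuous_sum => j.
have ce : {within `[0, 1], continuous (e j)} by exact: kl_continuous hKL _.
apply: within_continuousM => //; apply: within_continuousM => //.
by move=> t; exact: cvg_cst.
Qed.

(* Continuity only needs the Mercer tail to be small near the point considered:
   it is continuous, and small at that point for large [N]. *)
Lemma reweighted_kernel_continuous (R : realType) (K : R -> R -> R)
    (lam x : R ^nat) (e : nat -> R -> R) :
  covariance_kernel K -> karhunen_loeve K lam e ->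
  (forall j, 0 <= x j <= lam j) ->
  {within (`[0, 1] `*` `[0, 1] : set (R * R)%type),
    continuous (fun p : R * R => reweighted_kernel x e p.1 p.2)}.
Proof.
move=> hK hKL hx; apply/subspace_continuousP => -[s0 t0] [/= s001 t001].
apply/cvgrPdist_lt => eps eps0.
pose F := within (`[0, 1] `*` `[0, 1] : set (R * R)%type) (nbhs (s0, t0)).
have F01 : \forall p \near F, `[0, 1]%classic p.1 /\ `[0, 1]%classic p.2.
  by rewrite /F near_withinE; apply: nearW.
have cvg1 (h : R -> R) : {within `[0, 1], continuous h} ->
    (fun p : R * R => h p.1) @ F --> h s0.
  move=> /subspace_continuousP/(_ s0 s001); apply: cvg_comp.
  exact: cvg_fst_within.
have cvg2 (h : R -> R) : {within `[0, 1], continuous h} ->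
    (fun p : R * R => h p.2) @ F --> h t0.
  move=> /subspace_continuousP/(_ t0 t001); apply: cvg_comp.
  exact: cvg_snd_within.
pose S N (p : R * R) := \sum_(0 <= j < N) x j * e j p.1 * e j p.2.
have cS N : S N @ F --> S N (s0, t0).
  rewrite /S; elim: N => [|N IH].
    rewrite (_ : (fun _ => _) = cst 0); first by rewrite big_geq//; exact: cvg_cst.
    by apply/funext => p; rewrite big_geq.
  rewrite (_ : (fun _ => _) = (fun p : R * R =>
    \sum_(0 <= j < N) x j * e j p.1 * e j p.2 + x N * e N p.1 * e N p.2)).
    rewrite big_nat_recr//=; apply: cvgD; first exact: IH.
    have ce : {within `[0, 1], continuous (e N)} by exact: kl_continuous hKL _.
    apply: cvgM; last exact: cvg2.
    by apply: cvgM; [exact: cvg_cst|exact: cvg1].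
  by apply/funext => p; rewrite big_nat_recr.
(* Three errors below [eps / 4]: truncation at the base point, truncation at the nearby point, and
   variation of the partial sum. *)
have e4 : 0 < eps / 4 by rewrite divr_gt0.
have small r : `[0, 1]%classic r ->
    \forall N \near \oo, mercer_tail K lam e N r < eps / 4.
  move=> r01; have /cvgrPdist_lt/(_ _ e4) := kl_diagonal hKL r01.
  by apply: filterS => N /=; apply: le_lt_trans; exact: ler_norm.
have [N [sN tN]] : exists N, mercer_tail K lam e N s0 < eps / 4 /\
    mercer_tail K lam e N t0 < eps / 4.
  near \oo => N; exists N.
  by split; near: N; exact: small.
have ct := mercer_tail_continuous (N := N) hK hKL.
have n1 : \forall p \near F, mercer_tail K lam e N p.1 < eps / 4.
  exact: (cvg1 _ ct) (open_nbhs_nbhs (conj (@open_lt _ _) sN)).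
have n2 : \forall p \near F, mercer_tail K lam e N p.2 < eps / 4.
  exact: (cvg2 _ ct) (open_nbhs_nbhs (conj (@open_lt _ _) tN)).
have /cvgrPdist_lt/(_ _ e4) n3 := cS N.
near=> p.
have [p1 p2] : `[0, 1]%classic p.1 /\ `[0, 1]%classic p.2 by near: p.
have h1 : mercer_tail K lam e N p.1 < eps / 4 by near: p.
have h2 : mercer_tail K lam e N p.2 < eps / 4 by near: p.
have h3 : `|S N (s0, t0) - S N p| < eps / 4 by near: p.
have := reweighted_kernel_tail N hKL hx s001 t001.
have := reweighted_kernel_tail N hKL hx p1 p2.
move: h3; rewrite /S /= => h3 h4 h5.
change (`|reweighted_kernel x e s0 t0 - reweighted_kernel x e p.1 p.2| < eps).
rewrite ltr_norml; move: h3; rewrite ltr_norml => /andP[h3 h3'].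
move: h4 h5; rewrite !ler_norml => /andP[h4 h4'] /andP[h5 h5'].
by apply/andP; split; lra.
Unshelve. all: by end_near. Qed.

Lemma reweighted_kernel_covariance (R : realType) (K : R -> R -> R)
    (lam x : R ^nat) (e : nat -> R -> R) :
  covariance_kernel K -> karhunen_loeve K lam e ->
  (forall j, 0 <= x j <= lam j) -> covariance_kernel (reweighted_kernel x e).
Proof.
move=> hK hKL hx; have cK := reweighted_kernel_continuous hK hKL hx.
split => //.
- move=> s t _ _; congr (limn (series _)); apply/funext => j.
  by rewrite mulrAC.
- move=> n t c t01.
  (* For a truncated series the quadratic form is a sum of squares with weights [x j >= 0];
     nonnegativity passes to the limit. *)
  pose Q N := \sum_(i < n) \sum_(k < n)
    c i * c k * \sum_(0 <= j < N) x j * e j (t i) * e j (t k).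
  have Q0 N : 0 <= Q N.
    have -> : Q N = \sum_(0 <= j < N) x j * (\sum_(i < n) c i * e j (t i)) ^+ 2.
      rewrite /Q; under eq_bigr do under eq_bigr do rewrite mulr_sumr.
      under eq_bigr do rewrite exchange_big /=.
      rewrite exchange_big /=; apply: eq_bigr => j _.
      rewrite expr2 mulr_suml mulr_sumr; apply: eq_bigr => i _.
      by rewrite mulr_sumr mulr_sumr; apply: eq_bigr => k _; ring.
    by apply: sumr_ge0 => j _; rewrite mulr_ge0 ?sqr_ge0//; case/andP: (hx j).
  have cQ : Q @ \oo --> \sum_(i < n) \sum_(k < n)
      c i * c k * reweighted_kernel x e (t i) (t k).
    rewrite /Q; apply: cvg_big => [|i _]; first exact: add_continuous.
    apply: cvg_big => [|k _]; first exact: add_continuous.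
    apply: cvgMl_tmp.
    exact: reweighted_kernel_cvg hKL hx (t01 i) (t01 k).
  by rewrite -(cvg_lim _ cQ)//; apply: limr_ge; [exact: cvgP cQ|exact: nearW].
- apply: continuous_unit_integrable; move: cK => /subspace_continuousP cK.
  apply/subspace_continuousP => t t01.
  apply: (cvg_comp (fun t : R => (t, t)) _ _ (cK (t, t) (conj t01 t01))).
  move=> P; rewrite /within/= => -[[U V] [/= Ut Vt] h].
  by apply: filterS2 Ut Vt => s Us Vs s01; exact: (h (s, s)).
Qed.

Lemma reweighted_kernel_section_continuous (R : realType) (K : R -> R -> R)
    (lam x : R ^nat) (e : nat -> R -> R) (s : R) :
  covariance_kernel K -> karhunen_loeve K lam e ->
  (forall j, 0 <= x j <= lam j) -> `[0, 1]%classic s ->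
  {within `[0, 1], continuous (reweighted_kernel x e s)}.
Proof.
move=> hK hKL hx s01.
have /subspace_continuousP cK := reweighted_kernel_continuous hK hKL hx.
apply/subspace_continuousP => t t01.
apply: (cvg_comp (fun t : R => (s, t)) _ _ (cK (s, t) (conj s01 t01))).
move=> P; rewrite /within/= => -[[U V] [/= Us Vt] h].
apply: filterS Vt => r Vr r01; apply: (h (s, r)) => //=.
by split => //; exact: nbhs_singleton.
Qed.

(** The eigenvalue equation holds for truncated series by orthonormality, and passes to the limit by
    dominated convergence with the bound of [reweighted_partial_le]. *)
Lemma reweighted_kernel_kl (R : realType) (K : R -> R -> R)
    (lam x : R ^nat) (e : nat -> R -> R) :
  covariance_kernel K -> karhunen_loeve K lam e ->
  (forall j, 0 <= x j <= lam j) ->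
  karhunen_loeve (reweighted_kernel x e) x e.
Proof.
move=> hK hKL hx.
have ce j : {within `[0, 1], continuous (e j)} by exact: kl_continuous hKL _.
split => //.
- by move=> j; case/andP: (hx j).
- exact: kl_orthonormal hKL.
- move=> j s s01.
  pose h N t := (\sum_(0 <= i < N) x i * e i s * e i t) * e j t.
  have cst_c (r : R) : {within `[0, 1], continuous (fun _ : R => r)}.
    by move=> t; exact: cvg_cst.
  have cterm i : {within `[0, 1], continuous (fun t => x i * e i s * e i t)}.
    by apply: within_continuousM.
  have ch N : {within `[0, 1], continuous (h N)}.
    by apply: within_continuousM => //; apply: within_continuous_sum.
  have cl : {within `[0, 1], continuous (fun t => reweighted_kernel x e s t * e j t)}.
    apply: within_continuousM => //.
    exact: reweighted_kernel_section_continuous hK hKL hx s01.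
  have cg : {within `[0, 1],
      continuous (fun t => 2^-1 * (K s s + K t t) * `|e j t|)}.
    apply: within_continuousM; last first.
      by move=> t; apply: cvg_norm; exact: ce.
    apply: within_continuousM => //; apply: within_continuousD => //.
    exact: covariance_diagonal_continuous.
  have hN N : \int[lebesgue_measure]_(t in `[0, 1]%classic) h N t =
      \sum_(0 <= i < N) x i * e i s * (i == j)%:R.
    under eq_Rintegral do rewrite /h mulr_suml.
    rewrite Rintegral_sum_unit => [|i]; last exact: within_continuousM.
    apply: eq_bigr => i _; rewrite -(kl_orthonormal hKL) -RintegralZl//.
      by apply: eq_Rintegral => t _; rewrite mulrA.
    by apply: continuous_unit_integrable; exact: within_continuousM.
  have H : (fun N => \int[lebesgue_measure]_(t in `[0, 1]%classic) h N t) @ \oo -->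
      \int[lebesgue_measure]_(t in `[0, 1]%classic) (reweighted_kernel x e s t * e j t).
    have [] := @dominated_convergence _ _ R lebesgue_measure
      (`[0, 1]%classic) (measurable_itv _) (fun N t => (h N t)%:E)
      (fun t => (reweighted_kernel x e s t * e j t)%:E)
      (fun t => (2^-1 * (K s s + K t t) * `|e j t|)%:E).
    - by move=> N; have /measurable_int := continuous_unit_integrable (ch N).
    - by have /measurable_int := continuous_unit_integrable cl.
    - apply: aeW => t t01; apply: cvg_EFin; first exact: nearW.
      by apply: cvgMr_tmp; exact: reweighted_kernel_cvg hKL hx s01 t01.
    - exact: continuous_unit_integrable cg.
    - apply: aeW => t N t01; rewrite lee_fin normrM ler_wpM2r//.
      exact: reweighted_partial_le hKL hx s01 t01.
    move=> _ _.
    rewrite -[X in _ --> X]fineK; first by move=> /fine_cvg.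
    by apply: integrable_fin_num => //; exact: continuous_unit_integrable.
  have H' : (fun N => \int[lebesgue_measure]_(t in `[0, 1]%classic) h N t) @ \oo -->
      x j * e j s.
    apply: cvg_near_cst; near=> N; rewrite hN.
    have jN : (j < N)%N by near: N; exact: nbhs_infty_gt.
    rewrite big_mkord (bigD1 (Ordinal jN))//= eqxx mulr1 big1 ?addr0// => i ij.
    by rewrite (negbTE (_ : (i != j :> nat))) ?mulr0.
  exact: (cvg_unique (@Rhausdorff R) H H').
- move=> s t s01 t01.
  exact: reweighted_kernel_cvg hKL hx s01 t01.
Unshelve. all: by end_near. Qed.

(** * Comparative statics of the team size *)

(** The optimal spectrum satisfies [lamt j <= lam j], so reweighting the expansion of [K] yields a
    feasible process. *)
Lemma waterfilling_feasible (R : realType) (K : R -> R -> R) (lam : R ^nat)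
    (e : nat -> R -> R) (f : R -> R) (rho eta k n : R) (z : R ^nat) :
  covariance_kernel K -> karhunen_loeve K lam e -> baseline_spectrum lam ->
  0 < eta -> 1 <= k -> 0 < f k ->
  waterfilling lam eta^-1 (f k) (2 * k)^-1 n z -> allocation rho z ->
  exists (Kt : R -> R -> R) (lamt : R ^nat) (mu : R),
    feasible rho e k Kt lamt mu /\
    total_loss f lam eta k lamt mu =
      (eta / 2 * reduced_loss lam eta^-1 (f k) (2 * k)^-1 z)%:E.
Proof.
move=> hK hKL hl eta0 k1 f0 wz az.
have [lamt [mu [hx hw hE]]] := total_loss_waterfilling hl eta0 k1 f0 wz az.
have hx' j : 0 <= lamt j <= lam j by have /andP[/ltW -> ->] := hx j.
exists (reweighted_kernel lamt e), lamt, mu; split => //; split => //.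
- exact: reweighted_kernel_covariance hK hKL hx'.
- exact: reweighted_kernel_kl hK hKL hx'.
Qed.

(** Every feasible loss is bounded below by [eta / 2] times a reduced loss ([total_loss_ge]), and
    water-filling attains this bound ([waterfilling_feasible]). The factor [eta / 2] does not depend
    on the plan, so both problems select the same sizes. *)
Lemma optimal_team_sizeE (R : realType) (K : R -> R -> R) (lam : R ^nat)
    (e : nat -> R -> R) (f : R -> R) (rho eta k : R) :
  covariance_kernel K -> karhunen_loeve K lam e -> baseline_spectrum lam ->
  0 < rho -> (forall x, 1 <= x -> 0 < f x) -> 0 < eta ->
  optimal_team_size rho f lam e eta k <-> reduced_optimal lam rho f eta^-1 k.
Proof.
move=> hK hKL hl rho0 f0 eta0.
have t0 : 0 < eta^-1 by rewrite invr_gt0.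
have e20 : 0 < eta / 2 by rewrite divr_gt0.
have q0 (x : R) : 1 <= x -> 0 < (2 * x)^-1.
  by move=> x1; rewrite invr_gt0; lra.
split.
  move=> [Kt [lamt [mu [[k1 _ hKLt hw] hmin]]]]; split => //.
  have [n [z [wz az]]] := waterfilling_exists hl rho0 t0 (f0 k k1) (q0 k k1).
  exists n, z; split => // k' w k'1 aw.
  have [n' [z' [wz' az']]] := waterfilling_exists hl rho0 t0 (f0 k' k'1) (q0 k' k'1).
  have [Kt' [lamt' [mu' [fe' E']]]] :=
    waterfilling_feasible hK hKL hl eta0 k'1 (f0 k' k'1) wz' az'.
  have := hmin _ _ _ _ fe'; rewrite E'.
  have [->|[y [ay hy]]] :=
    total_loss_ge hl (kl_eigenvalue_ge0 hKLt) hw eta0 k1 (f0 k k1).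
    by rewrite leye_eq.
  move=> /(le_trans hy); rewrite lee_fin ler_pM2l// => hyz'.
  apply: (le_trans (waterfilling_min hl t0 (f0 k k1) (q0 k k1) wz az ay)).
  apply: (le_trans hyz').
  exact: waterfilling_min hl t0 (f0 k' k'1) (q0 k' k'1) wz' az' aw.
move=> [k1 [n [z [wz az hmin]]]].
have [Kt [lamt [mu [fe E]]]] :=
  waterfilling_feasible hK hKL hl eta0 k1 (f0 k k1) wz az.
exists Kt, lamt, mu; split => // k' Kt' lamt' mu' [k'1 _ hKLt hw]; rewrite E.
have [->|[y [ay hy]]] :=
  total_loss_ge hl (kl_eigenvalue_ge0 hKLt) hw eta0 k'1 (f0 k' k'1).
  exact: leey.
by apply: le_trans hy; rewrite lee_fin ler_pM2l//; exact: hmin.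
Qed.

Theorem theorem3p2 (R : realType)
    (K : R -> R -> R) (lam : nat -> R) (e : nat -> R -> R)
    (f : R -> R) (rho : R)
    (hK : covariance_kernel K)
    (hKL : karhunen_loeve K lam e)
    (hlam_gt0 : forall j, 0 < lam j)
    (hlam_noninc : forall i j : nat, (i <= j)%N -> lam j <= lam i)
    (hf_incr : forall x y, 1 <= x -> x < y -> f x < f y)
    (hf_diff : differentiable_from1 f)
    (hf1 : f 1 = 1)
    (hf_lim : f x @[x --> +oo] --> +oo)
    (hrho : 0 < rho) :
  [/\ forall eta, 0 < eta ->
        exists k, optimal_team_size rho f lam e eta k,
      forall eta1 eta2 k1 k2, 0 < eta1 -> eta1 < eta2 ->
        optimal_team_size rho f lam e eta1 k1 ->
        optimal_team_size rho f lam e eta2 k2 ->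
        k2 <= k1
    & exists k0, zero_attention_team_size f k0 /\
        forall kopt : R -> R,
          (forall eta, 0 < eta ->
             optimal_team_size rho f lam e eta (kopt eta)) ->
          kopt eta @[eta --> 0^'+] --> k0].
Proof.
have hl : baseline_spectrum lam by split => //; exact: kl_summable hK hKL.
have f0 x : 1 <= x -> 0 < f x.
  rewrite le_eqVlt => /predU1P[<-|x1]; first by rewrite hf1.
  by apply: lt_trans (hf_incr _ _ (lexx 1) x1); rewrite hf1.
have cf := differentiable_from1_continuous hf_diff.
have optE eta k : 0 < eta -> optimal_team_size rho f lam e eta k <->
    reduced_optimal lam rho f eta^-1 k.
  by move=> eta0; exact: optimal_team_sizeE hK hKL hl hrho f0 eta0.
split.
- move=> eta eta0; have t0 : 0 < eta^-1 by rewrite invr_gt0.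
  have [k ok] := reduced_optimal_exists hl hrho f0 cf hf_lim t0.
  by exists k; apply/optE.
- move=> eta1 eta2 k1 k2 eta10 eta12.
  have eta20 : 0 < eta2 := lt_trans eta10 eta12.
  move=> /(optE _ _ eta10) o1 /(optE _ _ eta20) o2.
  apply: (reduced_optimal_monotone hl hrho f0 hf_incr _ _ o1 o2).
    by rewrite invr_gt0.
  by rewrite ltf_pV2 ?posrE.
- have [k0 [zk0 hk0]] := reduced_optimal_limit hl hrho f0 hf_incr cf hf_lim.
  exists k0; split => // kopt hkopt; apply: hk0 => eta eta0.
  by apply/optE => //; exact: hkopt.
Qed.
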